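(* Let $K$ be the $so(n)$-valued curvature of the principal connection $\mathcal F^\pm$ of the rubber Chaplygin ball (see context). Let $\xi_1,\xi_2\in T_\gamma S^{n-1}$ and $(g,\mathbf r)\in\pi^{-1}(\gamma)$. Then $$K_{(g,\mathbf r)}(\xi_1^h,\xi_2^h)=\Big(1-\frac{\rho^2}{\sigma^2}\Big)\mathrm{Ad}_g(\xi_2\wedge\xi_1)=\frac{2\epsilon-1}{\epsilon^2}\,\mathrm{Ad}_g(\xi_2\wedge\xi_1).$$ In particular, for $\epsilon=1/2$, i.e. $\rho=\sigma$, the curvature vanishes and the constraints are holonomic (the distribution $\mathcal F^\pm$ is integrable).
   Context: Vectors of $\mathbb R^n$ are columns, $(x,y)=x^Ty$, $x\wedge y=xy^T-yx^T$, $\mathrm{Ad}_g(X)=gXg^{-1}$, $\langle X,Y\rangle=-\frac12\mathrm{tr}(XY)$ on $so(n)$. For $\gamma\in S^{n-1}$, $\mathfrak v_\gamma=\mathbb R^n\wedge\gamma$, $\mathfrak h_\gamma=\mathfrak v_\gamma^\perp$, and $\mathrm{pr}_{\mathfrak h_\gamma}$ is the orthogonal projection of $so(n)$ onto $\mathfrak h_\gamma$. A ball of radius $\rho>0$ rolls over a fixed sphere of radius $\sigma>0$ centered at the origin: sign $+$ for rolling over the outer surface; sign $-$ for rolling over the inner surface ($\sigma>\rho$) or for a spherical shell rolling around the fixed sphere in its interior ($\sigma<\rho$). Put $\epsilon=\frac\sigma{\sigma\pm\rho}$. The configuration space is the set of $(g,\mathbf r)$, $g\in SO(n)$, $\mathbf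 r\in\mathbb R^n$ with $(\mathbf r,\mathbf r)=(\sigma\pm\rho)^2$ (a sphere $S^{n-1}$). With $\omega=g^{-1}\dot g$, $\mathbf V=\dot{\mathbf r}$, the constraint distribution (no slipping, no twisting) is $$\mathcal F^\pm=\{(\omega,\mathbf V,g,\mathbf r)\mid\mathbf V=\pm\tfrac\rho{\sigma\pm\rho}\,\mathrm{Ad}_g(\omega)\mathbf r,\ \mathrm{pr}_{\mathfrak h_\gamma}\omega=0\},\qquad \gamma=\tfrac1{\sigma\pm\rho}g^{-1}\mathbf r .$$ The left $SO(n)$-action $a\cdot(g,\mathbf r)=(ag,a\mathbf r)$ defines the principal bundle $\pi:SO(n)\times S^{n-1}\to S^{n-1}$, $\pi(g,\mathbf r)=\gamma$, and $\mathcal F^\pm$ is a principal connection: $T_{(g,\mathbf r)}(SO(n)\times S^{n-1})=\mathcal F^\pm_{(g,\mathbf r)}\oplus\ker d\pi_{(g,\mathbf r)}$, $\ker d\pi_{(g,\mathbf r)}=so(n)\cdot(g,\mathbf r)$, where $\eta\cdot(g,\mathbf r)=\frac{d}{ds}\big|_{s=0}(\exp(s\eta)g,\exp(s\eta)\mathbf r)$. Vectors in $\mathcal F^\pm$ are horizontal, vectors in $\ker d\pi$ vertical; the horizontal lift $\xi^h$ of $\xi\in T_\gamma S^{n-1}$ at $(g,\mathbf r)\in\pi^{-1}(\gamma)$ is the unique vector of $\mathcal F^\pm_{(g,\mathbf r)}$ with $d\pi(\xi^h)=\xi$. Curvature: for $\zeta_1,\zeta_2\in\mathcal F^\pm_{(g,\mathbf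 r)}$, $K_{(g,\mathbf r)}(\zeta_1,\zeta_2)$ is the element $\eta\in so(n)$ such that $\eta\cdot(g,\mathbf r)$ is the vertical component of the commutator of vector fields $[X_2,X_1]$ at $(g,\mathbf r)$, where $X_1,X_2$ are smooth horizontal extensions of $\zeta_1,\zeta_2$. *)

(* Defs.v *)
From HB Require Import structures.
From mathcomp Require Import all_boot all_order all_algebra.
From mathcomp Require Import all_classical all_reals all_analysis.

Set Implicit Arguments.
Unset Strict Implicit.
Unset Printing Implicit Defensive.

Import Order.TTheory GRing.Theory Num.Theory.
Import numFieldNormedType.Exports.

Local Open Scope classical_set_scope.
Local Open Scope ring_scope.

Section SmoothCalculus.
Context {R : realType}.

(* C^k on U by iterated directional derivatives: on an open U of a
   finite-dimensional space this is the usual notion. *)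
Fixpoint Ck_on (V W : normedModType R) (k : nat) (U : set V) (f : V -> W) :
    Prop :=
  match k with
  | 0%N => forall x, U x -> {for x, continuous f}
  | k'.+1 => (forall x, U x -> differentiable f x) /\
             (forall v, Ck_on k' U (fun x => 'd f x v))
  end.

Definition smooth_on (V W : normedModType R) (U : set V) (f : V -> W) : Prop :=
  forall k, Ck_on k U f.

(* Sign convention: [X, Y] f = X (Y f) - Y (X f) on functions f. *)
Definition lie_bracket (V : normedModType R) (X Y : V -> V) (p : V) : V :=
  'd Y p (X p) - 'd X p (Y p).

(* Q is a submanifold of V and F assigns to q in Q a subspace of T_q Q.
   F is integrable when an integral manifold, given here by a smooth immersion
   phi into Q whose tangent spaces are the F q, passes through every point. *)
Definition integrable_distribution (V : normedModType R) (Q : set V)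
    (F : V -> set V) : Prop :=
  forall p, Q p ->
  exists k (W : set 'cV[R]_k) (phi : 'cV[R]_k -> V),
    [/\ open W, W 0, phi 0 = p, smooth_on W phi &
        forall x, W x ->
          [/\ Q (phi x), injective ('d phi x) & range ('d phi x) = F (phi x)]].

End SmoothCalculus.

Section EuclideanAndSo.
Context {R : realType} {n : nat}.

Definition dotv (x y : 'cV[R]_n) : R := (x^T *m y) ord0 ord0.

Definition wedge (x y : 'cV[R]_n) : 'M[R]_n := x *m y^T - y *m x^T.

Definition Ad (g X : 'M[R]_n) : 'M[R]_n := g *m X *m invmx g.

Definition SO : set 'M[R]_n := [set g | g^T *m g = 1%:M /\ \det g = 1].

Definition so : set 'M[R]_n := [set X | X^T = - X].

Definition so_dot (X Y : 'M[R]_n) : R := - (2^-1 * \tr (X *m Y)).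

Definition unit_sphere : set 'cV[R]_n := [set x | dotv x x = 1].

Definition sphere_tangent (x : 'cV[R]_n) : set 'cV[R]_n :=
  [set xi | dotv x xi = 0].

Definition v_space (gamma : 'cV[R]_n) : set 'M[R]_n :=
  [set wedge x gamma | x in [set: 'cV[R]_n]].

Definition h_space (gamma : 'cV[R]_n) : set 'M[R]_n :=
  [set X | so X /\ forall Y, v_space gamma Y -> so_dot X Y = 0].

Definition pr_h (gamma : 'cV[R]_n) (X : 'M[R]_n) : 'M[R]_n :=
  get [set Z | h_space gamma Z /\
               forall Y, h_space gamma Y -> so_dot (X - Z) Y = 0].

Definition expmx (A : 'M[R]_n) : 'M[R]_n :=
  limn (series (fun k : nat => (k`!%:R)^-1 *: A ^+ k)).

End EuclideanAndSo.

(* Outer: over the outer surface (sign +); Inner: over the inner surface, and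
   Shell: a spherical shell around the fixed sphere in its interior (sign -). *)
Inductive rolling := Outer | Inner | Shell.

(* The ambient vector space of the configuration space SO(n) x S^(n-1); a
   tangent vector at (g, r) is a pair (dg, dr), with omega = g^-1 dg and
   V = dr. *)
Notation ambient R n := ('M[R]_n * 'cV[R]_n)%type.

Section RubberChaplyginBall.
Context {R : realType} {n : nat}.
Variables (m : rolling) (sigma rho : R).
Implicit Types (p w z : ambient R n) (eta : 'M[R]_n).

Definition rolling_sign : R := if m is Outer then 1 else -1.

Definition rolling_radii : Prop :=
  match m with
  | Outer => True
  | Inner => rho < sigma
  | Shell => sigma < rho
  end.

(* sigma +- rho; negative for Shell *)
Definition center_dist : R := sigma + rolling_sign * rho.

Definition epsilon : R := sigma / center_dist.

Definition config : set (ambient R n) :=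
  [set p | SO p.1 /\ dotv p.2 p.2 = center_dist ^+ 2].

Definition omega p w : 'M[R]_n := invmx p.1 *m w.1.

Definition config_tangent p : set (ambient R n) :=
  [set w | so (omega p w) /\ dotv p.2 w.2 = 0].

(* The bundle map, extended by the same formula to the ambient space, where it
   is smooth near the configuration space; its differential in the directions
   of config_tangent does not depend on the extension. *)
Definition bundle_proj p : 'cV[R]_n :=
  center_dist^-1 *: (invmx p.1 *m p.2).

Definition horizontal p : set (ambient R n) :=
  [set w | [/\ config_tangent p w,
               w.2 = (rolling_sign * (rho / center_dist)) *:
                       (Ad p.1 (omega p w) *m p.2) &
               pr_h (bundle_proj p) (omega p w) = 0]].

Definition vertical p : set (ambient R n) :=
  [set w | config_tangent p w /\ 'd bundle_proj p w = 0].

Definition inf_action eta p : ambient R n :=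
  derive1 (fun s : R => (expmx (s *: eta) *m p.1, expmx (s *: eta) *m p.2) :
             ambient R n) 0.

Definition horizontal_lift p (xi : 'cV[R]_n) : ambient R n :=
  get [set w | horizontal p w /\ 'd bundle_proj p w = xi].

Definition horizontal_extension p z (X : ambient R n -> ambient R n) : Prop :=
  X p = z /\
  exists U : set (ambient R n),
    [/\ open U, U p, smooth_on U X &
        forall q, U q -> config q -> horizontal q (X q)].

Definition vertical_component p w v : Prop :=
  vertical p v /\ horizontal p (w - v).

Definition curvature p z1 z2 : 'M[R]_n :=
  get [set eta | so eta /\
         exists X1 X2, [/\ horizontal_extension p z1 X1,
                           horizontal_extension p z2 X2 &
           vertical_component p (lie_bracket X2 X1 p) (inf_action eta p)]].

End RubberChaplyginBall.

(* Main.v *)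
(* Let s = +1 or -1 be the sign, c = sigma + s rho, kappa = 1 / (s rho c).  At
   a configuration (g, r) the constraints amount to (r, dr) = 0 and
   dg = kappa (dr /\ r) g, while the vertical vectors are (eta g, eta r) with
   eta in so(n).  If X1, X2 are horizontal near p = (g, r) with dr-components
   b1, b2 at p, then differentiating these two equations for X1 along a curve
   of configurations with velocity X2, and vice versa, gives for W = [X2, X1]
     (r, W.2) = 0,
     W.1 = kappa (W.2 /\ r) g + kappa (2 - kappa c^2) (b1 /\ b2) g   at p,
   independently of the extensions.  As 1 - kappa c^2 <> 0, the vertical
   component of W is eta = kappa (2 - kappa c^2) b1 /\ b2.  The lift of xi has
   b = - (s rho c / sigma) g xi, which gives the formula.
   When rho = sigma, i.e. kappa c^2 = 2, the ball stays the mirror image of the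
   fixed one in the common tangent hyperplane: with H_u the reflection in the
   hyperplane orthogonal to u, the leaf through (g, c u0) is the set of
   (H_u H_u0 g, c u), u in the unit sphere, parametrized stereographically. *)

Require Import Defs.
From HB Require Import structures.
From mathcomp Require Import all_boot all_order all_algebra.
From mathcomp Require Import all_classical all_reals all_analysis.
From mathcomp Require Import ring lra.

Set Implicit Arguments.
Unset Strict Implicit.
Unset Printing Implicit Defensive.

Import Order.TTheory GRing.Theory Num.Theory.
Import numFieldNormedType.Exports.

Local Open Scope classical_set_scope.
Local Open Scope ring_scope.

(** * Differentials from quadratic remainder bounds, and the product rule *)

Lemma lipschitz_linear_continuous (R : realType) (V W : normedModType R)
    (L : {linear V -> W}) (C : R) :
  (forall h, `|L h| <= C * `|h|) -> continuous L.
Proof.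
move=> LC; apply/linear_bounded_continuous/linear_boundedP.
near=> k => x; apply: (le_trans (LC x)); apply: ler_wpM2r => //.
Unshelve. all: by end_near. Qed.

(** A remainder of order [|h| ^+ 2] is little-o of [h], so uniqueness of the differential identifies
    it with [L]. Bilinear maps, matrix inversion and the exponential are all differentiated in this
    way. *)
Lemma is_diff_quadratic (R : realType) (V W : normedModType R) (f : V -> W)
    (L : {linear V -> W}) (x : V) (C : R) :
  continuous L ->
  (\forall h \near (0 : V), `|f (x + h) - f x - L h| <= C * `|h| ^+ 2) ->
  is_diff x f L.
Proof.
move=> Lc fL.
have E : f \o shift x = cst (f x) + L +o_ (0 : V) id.
  apply/eqaddoP => e e0; near=> h.
  have -> : (f \o shift x - (cst (f x) + L)) h = f (x + h) - f x - L h.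
    by rewrite /= !fctE /= opprD addrA [h + x]addrC.
  apply: le_trans (near fL h _) _ => //.
  (* [C] has no prescribed sign; [|C| + 1] is positive, so it can be inverted to bound the size of
     [h]. *)
  apply: (@le_trans _ _ ((`|C| + 1) * `|h| ^+ 2)).
    apply: ler_wpM2r; first exact: exprn_ge0.
    by rewrite (le_trans (ler_norm _))// lerDl.
  rewrite expr2 mulrA; apply: ler_wpM2r => //.
  rewrite -ler_pdivlMl ?ltr_wpDl//.
  near: h; apply: nbhs0_le.
  by rewrite mulr_gt0// invr_gt0 ltr_wpDl.
have D := diff_unique Lc E.
by apply: DiffDef => //; apply/diff_locallyP; rewrite D.
Unshelve. all: by end_near. Qed.

Lemma mx_norm_le (R : realType) (m n : nat) (A : 'M[R]_(m, n)) (c : R) :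
  0 <= c -> (forall i j, `|A i j| <= c) -> `|A| <= c.
Proof.
move=> c0 Ac; rewrite [`|A|]mx_normrE.
by apply: bigmax_le => // -[i j] _; apply: Ac.
Qed.

Lemma le_mx_norm (R : realType) (m n : nat) (A : 'M[R]_(m, n)) i j :
  `|A i j| <= `|A|.
Proof.
rewrite [leRHS]mx_normrE.
exact: (le_bigmax _ (fun ij => `|A ij.1 ij.2|) (i, j)).
Qed.

(** The norm is the largest absolute value of an entry, so it is submultiplicative only up to the
    inner dimension. The factors [n%:R] in later estimates stem from this. *)
Lemma mx_normM (R : realType) (m n p : nat) (A : 'M[R]_(m, n))
    (B : 'M[R]_(n, p)) : `|A *m B| <= n%:R * `|A| * `|B|.
Proof.
apply: mx_norm_le => [|i j]; first by rewrite !mulr_ge0.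
rewrite mxE; apply: le_trans (ler_norm_sum _ _ _) _.
rewrite -[n in n%:R]card_ord -mulrA mulr_natl -sumr_const ler_sum// => k _.
by rewrite normrM ler_pM// le_mx_norm.
Qed.

Lemma mx_norm_tr (R : realType) (m n : nat) (A : 'M[R]_(m, n)) : `|A^T| = `|A|.
Proof.
by apply/le_anti/andP; split; apply: mx_norm_le => // i j;
  rewrite ?mxE ?le_mx_norm// -[A]trmxK mxE trmxK le_mx_norm.
Qed.

Lemma norm_fst (R : realType) (V W : normedModType R) (p : V * W) :
  `|p.1| <= `|p|.
Proof. by rewrite prod_normE le_max lexx. Qed.

Lemma norm_snd (R : realType) (V W : normedModType R) (p : V * W) :
  `|p.2| <= `|p|.
Proof. by rewrite prod_normE le_max lexx orbT. Qed.

Lemma is_diff_lin (R : realType) (V W : normedModType R) (L : {linear V -> W})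
    (x : V) : continuous L -> is_diff x L L.
Proof.
by move=> Lc; apply: DiffDef; [exact: linear_differentiable | exact: diff_lin].
Qed.

Lemma trmx_continuous (R : realType) (m n : nat) :
  continuous (@trmx R m n).
Proof.
apply: (@lipschitz_linear_continuous _ _ _ (@trmx R m n) 1) => A.
by rewrite mul1r mx_norm_tr.
Qed.

Lemma mulmx_continuous (R : realType) (m n k : nat) (N : 'M[R]_(m, n)) :
  continuous (mulmx N : 'M[R]_(n, k) -> 'M[R]_(m, k)).
Proof.
apply: (@lipschitz_linear_continuous _ _ _
  (mulmx N : {linear 'M[R]_(n, k) -> 'M[R]_(m, k)}) (n%:R * `|N|)) => x.
exact: mx_normM.
Qed.

(** Stated for plain functions, so that one product rule and one smoothness lemma serve the matrix
    product, scaling, [dotv] and [wedge] alike. *)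
Definition bounded_bilinear (R : realType) (U V W : normedModType R)
    (B : U -> V -> W) : Prop :=
  [/\ forall u, linear (B u), forall v, linear (B ^~ v) &
      exists C : R, 0 <= C /\ forall u v, `|B u v| <= C * `|u| * `|v|].

Lemma mulmx_bounded_bilinear (R : realType) (m n p : nat) :
  bounded_bilinear (@mulmx R m n p).
Proof.
split=> [A a u v|A a u v|]; rewrite ?linearP ?mulmxDl -?scalemxAl//.
by exists n%:R; split=> // A B; apply: mx_normM.
Qed.

Lemma scale_bounded_bilinear (R : realType) (V : normedModType R) :
  bounded_bilinear (fun (a : R) (v : V) => a *: v).
Proof.
split=> [b a u v|b a u v|] /=.
- by rewrite scalerDr !scalerA mulrC.
- by rewrite scalerDl scalerA.
- by exists 1; split=> // a v; rewrite mul1r normrZ.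
Qed.

(** The remainder of [B] at a point is exactly [B h.1 h.2], hence quadratic in [h]; the chain rule
    through the pair of [f] and [g] gives the rest. *)
Lemma is_diff_bilinear (R : realType) (T U V W : normedModType R)
    (B : U -> V -> W) (f df : T -> U) (g dg : T -> V) (x : T) :
  bounded_bilinear B -> is_diff x f df -> is_diff x g dg ->
  is_diff x (fun y => B (f y) (g y)) (fun v => B (f x) (dg v) + B (df v) (g x)).
Proof.
move=> [Blr Bll [C [C0 BC]]] Df Dg.
have BDr u v w : B u (v + w) = B u v + B u w.
  by have := Blr u 1 v w; rewrite !scale1r.
have BDl u v w : B (u + v) w = B u w + B v w.
  by have := Bll w 1 u v; rewrite !scale1r.
pose d (q : U * V) := B (f x) q.2 + B q.1 (g x).
have lind : linear d.
  by move=> a u v; rewrite /d /= Blr Bll scalerDr addrACA.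
pose dL : {linear _ -> _} := HB.pack d (GRing.isLinear.Build _ _ _ _ _ lind).
have dc : continuous dL.
  apply: (@lipschitz_linear_continuous _ _ _ dL
    (C * `|f x| + C * `|g x|)) => h.
  apply: le_trans (ler_normD _ _) _; rewrite mulrDl lerD//.
    by apply: le_trans (BC _ _) _; rewrite ler_wpM2l ?mulr_ge0 ?norm_snd.
  apply: le_trans (BC _ _) _; rewrite mulrAC ler_wpM2l ?mulr_ge0 //.
  exact: norm_fst.
have DB : is_diff (f x, g x) (fun q : U * V => B q.1 q.2) dL.
  apply: (@is_diff_quadratic _ _ _ _ _ _ C dc); near=> h.
  have -> : (f x, g x) + h = (f x + h.1, g x + h.2) by case: (h).
  rewrite /= /d BDl !BDr.
  have -> : B (f x) (g x) + B (f x) h.2 + (B h.1 (g x) + B h.1 h.2)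
      - B (f x) (g x) - (B (f x) h.2 + B h.1 (g x)) = B h.1 h.2.
    apply/eqP; rewrite !subr_eq [eqbRHS]addrC [B h.1 h.2 + _]addrC.
    by rewrite !addrA.
  apply: le_trans (BC _ _) _; rewrite -mulrA ler_wpM2l// expr2.
  by rewrite ler_pM ?norm_fst ?norm_snd.
have := is_diff_comp (is_diff_pair Df Dg) DB.
exact.
Unshelve. all: by end_near. Qed.

Lemma fst_continuous (R : realType) (V W : normedModType R) :
  continuous (@fst V W).
Proof.
apply: (@lipschitz_linear_continuous _ _ _ (@fst V W) 1) => p.
by rewrite mul1r norm_fst.
Qed.

Lemma snd_continuous (R : realType) (V W : normedModType R) :
  continuous (@snd V W).
Proof.
apply: (@lipschitz_linear_continuous _ _ _ (@snd V W) 1) => p.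
by rewrite mul1r norm_snd.
Qed.

(** * Closure properties of C^k and smooth maps *)

Lemma Ck_onS (R : realType) (V W : normedModType R) k (U : set V) (f : V -> W) :
  Ck_on k.+1 U f -> Ck_on k U f.
Proof.
elim: k f => [|k IH] f /= [fd fC]; last by split=> // v; apply: IH.
by move=> x Ux; apply/differentiable_continuous/fd.
Qed.

Lemma bilinear_continuous (R : realType) (U V W : normedModType R)
    (B : U -> V -> W) : bounded_bilinear B -> continuous (fun q => B q.1 q.2).
Proof.
move=> BB q; apply: differentiable_continuous.
have D1 := is_diff_lin q (@fst_continuous _ U V).
have D2 := is_diff_lin q (@snd_continuous _ U V).
exact: (@ex_diff _ _ _ _ _ _ _ (is_diff_bilinear BB D1 D2)).
Qed.

Section CkClosure.
Context {R : realType} {V : normedModType R}.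

Lemma Ck_onD (W : normedModType R) k (f g : V -> W) :
  Ck_on k setT f -> Ck_on k setT g -> Ck_on k setT (fun x => f x + g x).
Proof.
elim: k f g => [|k IH] f g /=.
  by move=> fc gc x _; apply: continuousD; [exact: fc|exact: gc].
move=> [fd fC] [gd gC]; split=> [x _|v].
  by apply: differentiableD; [exact: fd|exact: gd].
rewrite (_ : (fun x => _) = (fun x => 'd f x v + 'd g x v)); first exact: IH.
by apply/funext => x; rewrite diffD; [|exact: fd|exact: gd].
Qed.

Lemma Ck_onN (W : normedModType R) k (f : V -> W) :
  Ck_on k setT f -> Ck_on k setT (fun x => - f x).
Proof.
elim: k f => [|k IH] f /=.
  by move=> fc x _; apply: continuousN; exact: fc.
move=> [fd fC]; split=> [x _|v]; first by apply: differentiableN; exact: fd.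
rewrite (_ : (fun x => _) = (fun x => - 'd f x v)); first exact: IH.
by apply/funext => x; rewrite diffN//; exact: fd.
Qed.

Lemma Ck_on_bilinear (T U W : normedModType R) (B : T -> U -> W) k
    (f : V -> T) (g : V -> U) :
  bounded_bilinear B -> Ck_on k setT f -> Ck_on k setT g ->
  Ck_on k setT (fun x => B (f x) (g x)).
Proof.
move=> BB; elim: k f g => [|k IH] f g.
  move=> fc gc x _; have fgc : {for x, continuous (fun y => (f y, g y))}.
    by apply: cvg_pair; [exact: fc | exact: gc].
  apply: (@continuous_comp _ _ _ (fun y => (f y, g y))
    (fun q => B q.1 q.2)) => //.
  exact: bilinear_continuous.
move=> fS gS; have [fd fC] := fS; have [gd gC] := gS.
have D x := is_diff_bilinear BB (differentiableP (fd x I))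
  (differentiableP (gd x I)).
split=> [x _|v]; first by have [] := D x.
rewrite (_ : (fun x => _) =
  (fun x => B (f x) ('d g x v) + B ('d f x v) (g x))).
  apply: Ck_onD; apply: IH.
  - exact: Ck_onS fS.
  - exact: gC.
  - exact: fC.
  - exact: Ck_onS gS.
by apply/funext => x; rewrite (@diff_val _ _ _ _ _ _ _ (D x)).
Qed.

Lemma Ck_onV k (f : V -> R) : (forall x, f x != 0) -> smooth_on setT f ->
  Ck_on k setT (fun x => (f x)^-1).
Proof.
move=> f0 fS; elim: k => [|k IH].
  by move=> x _; apply: continuousV => //; exact: (fS 0%N).
have [fd _] := fS 1%N.
split=> [x _|v]; first by apply: differentiableV => //; exact: fd.
(* The derivative - f^-2 df is written as a product in which each power of f is a reciprocal, so
   that the induction hypothesis applies. *)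
rewrite (_ : (fun x => _) =
  (fun x => ((f x)^-1 *: - (f x)^-1) *: ('d f x v : R))).
  refine (@Ck_on_bilinear _ _ _ _ k (fun x => _) (fun x => _)
    (scale_bounded_bilinear R) _ _); last exact: (proj2 (fS k.+1)).
  refine (@Ck_on_bilinear _ _ _ _ k (fun x => _) (fun x => _)
    (scale_bounded_bilinear R) _ _); first exact: IH.
  exact: Ck_onN.
apply/funext => x; rewrite diffV//; last exact: fd.
congr (_ * _); rewrite -[RHS]/((f x)^-1 * - (f x)^-1) mulrN.
by rewrite -exprVn expr2.
Qed.

Lemma smooth_cst (W : normedModType R) (a : W) :
  smooth_on setT (fun _ : V => a).
Proof.
move=> k; elim: k a => [|k IH] a; first by move=> x _; exact: cst_continuous.
split=> [x _|v]; first exact: differentiable_cst.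
rewrite (_ : (fun x => _) = (fun _ : V => 0)); first exact: IH.
by apply/funext => x; rewrite diff_cst.
Qed.

Lemma smooth_linear (W : normedModType R) (L : {linear V -> W}) :
  continuous L -> smooth_on setT L.
Proof.
move=> Lc [|k]; first by move=> x _; exact: Lc.
split=> [x _|v]; first exact: linear_differentiable.
rewrite (_ : (fun x => _) = (fun _ : V => L v)); first exact: smooth_cst.
by apply/funext => x; rewrite diff_lin.
Qed.

Lemma smooth_linear_comp (W T : normedModType R) (L : {linear W -> T})
    (f : V -> W) : continuous L -> smooth_on setT f ->
  smooth_on setT (fun x => L (f x)).
Proof.
move=> Lc fS k; elim: k f fS => [|k IH] f fS.
  move=> x _; apply: (@continuous_comp _ _ _ f L); first exact: (fS 0%N).
  exact: Lc.
have [fd _] := fS 1%N.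
have D x := is_diff_comp (differentiableP (fd x I)) (is_diff_lin (f x) Lc).
split=> [x _|v]; first by have [] := D x.
rewrite (_ : (fun x => _) = (fun x => L ('d f x v))).
  by apply: IH => l; exact: (proj2 (fS l.+1)).
by apply/funext => x; rewrite (@diff_val _ _ _ _ _ _ _ (D x)).
Qed.

Lemma smooth_pair (W T : normedModType R) (f : V -> W) (g : V -> T) :
  smooth_on setT f -> smooth_on setT g -> smooth_on setT (fun x => (f x, g x)).
Proof.
move=> fS gS k; elim: k f g fS gS => [|k IH] f g fS gS.
  by move=> x _; apply: cvg_pair; [exact: (fS 0%N)|exact: (gS 0%N)].
have [fd _] := fS 1%N; have [gd _] := gS 1%N.
split=> [x _|v]; first by apply: differentiable_pair; [exact: fd|exact: gd].
rewrite (_ : (fun x => _) = (fun x => ('d f x v, 'd g x v))).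
  by apply: IH => l; [exact: (proj2 (fS l.+1))|exact: (proj2 (gS l.+1))].
by apply/funext => x; rewrite diff_pair; [|exact: fd|exact: gd].
Qed.

Lemma smoothD (W : normedModType R) (f g : V -> W) :
  smooth_on setT f -> smooth_on setT g -> smooth_on setT (fun x => f x + g x).
Proof. by move=> fS gS k; exact: Ck_onD. Qed.

Lemma smoothN (W : normedModType R) (f : V -> W) :
  smooth_on setT f -> smooth_on setT (fun x => - f x).
Proof. by move=> fS k; exact: Ck_onN. Qed.

Lemma smooth_bilinear (T U W : normedModType R) (B : T -> U -> W)
    (f : V -> T) (g : V -> U) : bounded_bilinear B ->
  smooth_on setT f -> smooth_on setT g ->
  smooth_on setT (fun x => B (f x) (g x)).
Proof. by move=> BB fS gS k; exact: Ck_on_bilinear. Qed.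

Lemma smoothV (f : V -> R) : (forall x, f x != 0) -> smooth_on setT f ->
  smooth_on setT (fun x => (f x)^-1).
Proof. by move=> f0 fS k; exact: Ck_onV. Qed.

End CkClosure.

(** * Matrix inversion, and the matrix exponential near 0 *)

Section MatrixFunctions.
Context {R : realType} {n : nat}.
Implicit Types A B : 'M[R]_n.

Lemma mx_normM3 (m p : nat) (A : 'M[R]_(p, m)) (B : 'M[R]_(m, n))
    (C : 'M[R]_n) :
  `|A *m B *m C| <= m%:R * n%:R * `|C| * `|B| * `|A|.
Proof.
apply: le_trans (mx_normM _ _) _.
have -> : m%:R * n%:R * `|C| * `|B| * `|A| =
  n%:R * (m%:R * `|A| * `|B|) * `|C| by ring.
by rewrite ler_wpM2r// ler_wpM2l// mx_normM.
Qed.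

(** With G and B the inverses of A and A + H, the resolvent identity B - G = - B H G, used twice,
    turns the remainder B - G + G H G into B H G H G. This is quadratic in H as soon as B is
    bounded. *)
Lemma is_diff_invmx A : A \in unitmx ->
  is_diff A (@invmx R n) (fun H => - (invmx A *m H *m invmx A)).
Proof.
move=> Au; set G := invmx A; set K := n%:R * n%:R * `|G|.
have K0 : 0 <= K by rewrite !mulr_ge0.
pose d (H : 'M[R]_n) := - (G *m H *m G).
have lind : linear d.
  move=> a u v; rewrite /d mulmxDr mulmxDl -scalemxAr -scalemxAl opprD.
  by rewrite scalerN.
pose dL : {linear _ -> _} := HB.pack d (GRing.isLinear.Build _ _ _ _ _ lind).
apply: (@is_diff_quadratic _ _ _ _ dL _ (2 * K ^+ 2 * `|G|)).
  apply: (@lipschitz_linear_continuous _ _ _ dL (K * `|G|)) => H.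
  by rewrite /= /d normrN -mulrA [`|G| * _]mulrC mulrA mx_normM3.
near=> H.
(* This smallness gives both facts needed about A + H: a row vector v in its kernel has |v| <= |v| /
   2, hence is 0, and the inverse is bounded by 2 |G|. *)
have KH : K * `|H| <= 2^-1.
  suff : `|H| <= (K + 1)^-1 * 2^-1.
    rewrite ler_pdivlMl ?ltr_wpDl// => /(le_trans _); apply.
    by rewrite ler_wpM2r// lerDl.
  near: H; apply: (@nbhs0_le _ 'M[R]_n).
  by rewrite mulr_gt0 ?invr_gt0 ?ltr_wpDl.
have AHu : A + H \in unitmx.
  rewrite -row_free_unit; apply: inj_row_free => v.
  rewrite mulmxDr => /eqP; rewrite addr_eq0 => /eqP vA.
  have {vA} : `|v| <= K * `|H| * `|v|.
    rewrite -[X in `|X| <= _](mulmxK Au) vA mulNmx normrN.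
    exact: mx_normM3.
  move=> h; apply/eqP; rewrite -normr_le0.
  have h2 : K * `|H| * `|v| <= 2^-1 * `|v| by exact: ler_wpM2r.
  by lra.
set B := invmx (A + H).
have BG : B - G = - (B *m H *m G).
  have : B *m (A + H) *m G = G by rewrite mulVmx// mul1mx.
  rewrite mulmxDr mulmxDl mulmxK// => E.
  by rewrite -[in LHS]E opprD addrA subrr add0r.
have nB : `|B| <= 2 * `|G|.
  have h1 : `|B| <= `|G| + K * `|H| * `|B|.
    rewrite -[X in `|X| <= _](subrK G B) addrC.
    by apply: le_trans (ler_normD _ _) _; rewrite lerD2l BG normrN mx_normM3.
  have h2 : K * `|H| * `|B| <= 2^-1 * `|B| by exact: ler_wpM2r.
  by lra.
have -> : B - G - dL H = B *m H *m G *m H *m G.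
  rewrite BG /= /d opprK -!mulNmx -!mulmxDl [- B + G]addrC -[G - B]opprB BG.
  by rewrite opprK.
apply: le_trans (mx_normM3 _ _ _) _.
apply: (@le_trans _ _ (K * `|H| * (K * `|H| * (2 * `|G|)))).
  apply: ler_wpM2l; first by rewrite mulr_ge0.
  apply: le_trans (mx_normM3 _ _ _) _.
  by apply: ler_wpM2l => //; rewrite mulr_ge0.
by rewrite le_eqVlt; apply/orP; left; apply/eqP; ring.
Unshelve. all: by end_near. Qed.

Lemma mx_norm_expr A k : `|A ^+ k| <= (n%:R * `|A|) ^+ k.
Proof.
elim: k => [|k IH].
  rewrite !expr0; apply: mx_norm_le => // i j.
  by rewrite mxE; case: (i == j); rewrite ?normr0 ?normr1.
rewrite exprS [_ ^+ k.+1 in leRHS]exprS; apply: le_trans (mx_normM _ _) _.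
by rewrite ler_wpM2l// mulr_ge0.
Qed.

Lemma scalemx_expr (s : R) A k : (s *: A) ^+ k = s ^+ k *: A ^+ k.
Proof.
elim: k => [|k IH]; first by rewrite !expr0 scale1r.
by rewrite !exprS IH -!mulmxE -scalemxAl -scalemxAr scalerA.
Qed.

Definition expmx_term A k : 'M[R]_n := (k`!%:R)^-1 *: A ^+ k.

Lemma expmx_term_norm A k : `|expmx_term A k| <= exp_coeff (n%:R * `|A|) k.
Proof.
rewrite normrZ /exp_coeff /= mulrC ger0_norm ?invr_ge0//.
by rewrite ler_wpM2r ?invr_ge0// mx_norm_expr.
Qed.

HB.instance Definition _ := Complete.on 'M[R]_n.

(** The series converges absolutely, being dominated by the scalar exponential series at
    [n%:R * |A|]. *)
Lemma is_cvg_expmx A : cvgn (series (expmx_term A)).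
Proof.
apply: normed_cvg.
apply: (series_le_cvg _ _ (expmx_term_norm A)) => [k|k|] //.
- by rewrite exp_coeff_ge0// mulr_ge0.
- exact: is_cvg_series_exp_coeff.
Qed.

(** For |s| <= 1 every power s^k with k >= 2 is at most s^2 in absolute value, so the tail after the
    first two terms is at most s^2 times a scalar exponential series. This first-order behaviour at
    0 is what [inf_actionE] rests on. *)
Lemma expmx_quadratic A (s : R) : `|s| <= 1 ->
  `|expmx (s *: A) - (1%:M + s *: A)| <= expR (n%:R * `|A|) * `|s| ^+ 2.
Proof.
move=> s1; set a := n%:R * `|A|; set u := expmx_term (s *: A).
have a0 : 0 <= a by rewrite mulr_ge0.
have partial N : `|series u N.+2 - (1%:M + s *: A)| <=
    series (exp_coeff a) N.+2 * `|s| ^+ 2.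
  elim: N => [|N IH].
    rewrite /series /= big_nat_recr// big_nat1 /=.
    rewrite /u /expmx_term !fact0 ?factS ?fact0 !expr0 expr1 !invr1 !scale1r.
    rewrite subrr normr0 mulr_ge0 ?exprn_ge0// sumr_ge0// => k _.
    exact: exp_coeff_ge0.
  rewrite /series /= big_nat_recr//= [in leRHS]big_nat_recr//= mulrDl.
  rewrite addrAC; apply: le_trans (ler_normD _ _) _; rewrite lerD//.
  rewrite /u /expmx_term scalemx_expr scalerA normrZ normrM normrX.
  rewrite ger0_norm ?invr_ge0// /exp_coeff /=.
  rewrite -mulrA [leRHS]mulrAC mulrC ler_wpM2r ?invr_ge0//.
  rewrite mulrC ler_pM ?exprn_ge0 ?mx_norm_expr//.
  by rewrite -[N.+2]addn2 exprD ler_piMl ?exprn_ile1 ?exprn_ge0.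
have cu : cvgn (series u) by exact: is_cvg_expmx.
have cn : `|series u k - (1%:M + s *: A)| @[k --> \oo] -->
    `|expmx (s *: A) - (1%:M + s *: A)|.
  by apply: cvg_norm; apply: cvgB => //; exact: cvg_cst.
rewrite -(cvg_lim _ cn)//; apply: limr_le; first exact: cvgP cn.
near=> k; have -> : k = (k - 2).+2.
  by rewrite -addn2 subnK//; near: k; exact: nbhs_infty_ge.
apply: le_trans (partial _) _; apply: ler_wpM2r; first exact: exprn_ge0.
apply: nondecreasing_cvgn_le; last exact: is_cvg_series_exp_coeff.
by apply: nondecreasing_series => j _ _; exact: exp_coeff_ge0.
Unshelve. all: by end_near. Qed.

Lemma expmx0 : expmx (0 : 'M[R]_n) = 1%:M.
Proof.
have := @expmx_quadratic 0 0.
rewrite normr0 expr0n mulr0 scaler0 addr0 => /(_ ler01).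
by rewrite normr_le0 subr_eq0 => /eqP.
Qed.

Lemma is_diff_expmx_line A :
  is_diff (0 : R) (fun s : R => expmx (s *: A)) (fun s => s *: A).
Proof.
have lind : linear (fun s : R => s *: A).
  by move=> a u v; rewrite scalerDl scalerA.
pose dL : {linear R -> 'M[R]_n} :=
  HB.pack (fun s : R => s *: A) (GRing.isLinear.Build _ _ _ _ _ lind).
apply: (@is_diff_quadratic _ R _ _ dL _ (expR (n%:R * `|A|))).
  exact: scalel_continuous.
near=> h; rewrite add0r scale0r expmx0 -addrA -opprD /=.
by apply: expmx_quadratic; near: h; apply: (@nbhs0_le _ R).
Unshelve. all: by end_near. Qed.

Lemma inf_actionE A (p : ambient R n) :
  inf_action A p = (A *m p.1, A *m p.2).
Proof.
have D := is_diff_expmx_line A.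
have D1 := is_diff_bilinear (mulmx_bounded_bilinear R n n n) D
  (is_diff_cst p.1 (0 : R)).
have D2 := is_diff_bilinear (mulmx_bounded_bilinear R n n 1) D
  (is_diff_cst p.2 (0 : R)).
have D12 := is_diff_pair D1 D2.
rewrite /inf_action derive1E'; last exact: (@ex_diff _ _ _ _ _ _ _ D12).
rewrite (@diff_val _ _ _ _ _ _ _ D12) /= !mulmx0 !add0r !scale1r.
by [].
Qed.

End MatrixFunctions.

(** * Euclidean algebra, the trace form on so(n) and the projection onto h_gamma *)

Lemma dotv_mull (R : realType) (m n : nat) (X : 'M[R]_(m, n)) (x : 'cV_n)
    (y : 'cV_m) : dotv (X *m x) y = dotv x (X^T *m y).
Proof. by rewrite /dotv trmx_mul mulmxA. Qed.

Section EuclideanAlgebra.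
Context {R : realType} {n : nat}.
Implicit Types (x y z w : 'cV[R]_n) (X Y Z g : 'M[R]_n) (a : R).

Lemma mulmx_trcol x y : x^T *m y = (dotv x y)%:M.
Proof. exact: mx11_scalar. Qed.

Lemma dotvC x y : dotv x y = dotv y x.
Proof.
by rewrite /dotv -[in RHS](trmxK x) -trmx_mul [RHS]mxE.
Qed.

Lemma dotvDl x y z : dotv (x + y) z = dotv x z + dotv y z.
Proof. by rewrite /dotv linearD mulmxDl mxE. Qed.

Lemma dotvZl a x y : dotv (a *: x) y = a * dotv x y.
Proof. by rewrite /dotv linearZ /= -scalemxAl mxE. Qed.

Lemma dotvNl x y : dotv (- x) y = - dotv x y.
Proof. by rewrite -scaleN1r dotvZl mulN1r. Qed.

Lemma dotvBl x y z : dotv (x - y) z = dotv x z - dotv y z.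
Proof. by rewrite dotvDl dotvNl. Qed.

Lemma dotvDr x y z : dotv z (x + y) = dotv z x + dotv z y.
Proof. by rewrite dotvC dotvDl !(dotvC z). Qed.

Lemma dotvZr a x y : dotv y (a *: x) = a * dotv y x.
Proof. by rewrite dotvC dotvZl dotvC. Qed.

Lemma dotvNr x y : dotv y (- x) = - dotv y x.
Proof. by rewrite dotvC dotvNl dotvC. Qed.

Lemma dotvBr x y z : dotv z (x - y) = dotv z x - dotv z y.
Proof. by rewrite dotvC dotvBl !(dotvC z). Qed.

Lemma dotv_sum x y : dotv x y = \sum_i x i 0 * y i 0.
Proof. by rewrite /dotv mxE; apply: eq_bigr => i _; rewrite mxE. Qed.

Lemma dotv_ge0 x : 0 <= dotv x x.
Proof. by rewrite dotv_sum sumr_ge0// => i _; rewrite -expr2 sqr_ge0. Qed.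

Lemma outer_mulmx x y z : x *m y^T *m z = dotv y z *: x.
Proof. by rewrite -mulmxA mulmx_trcol mul_mx_scalar. Qed.

Lemma outerM x y z w : x *m y^T *m (z *m w^T) = dotv y z *: (x *m w^T).
Proof. by rewrite mulmxA outer_mulmx -scalemxAl. Qed.

Lemma wedge_mulmx x y z : wedge x y *m z = dotv y z *: x - dotv x z *: y.
Proof. by rewrite mulmxBl !outer_mulmx. Qed.

Lemma wedgeC x y : wedge x y = - wedge y x.
Proof. by rewrite /wedge opprB. Qed.

Lemma tr_wedge x y : (wedge x y)^T = - wedge x y.
Proof. by rewrite /wedge linearB /= !trmx_mul !trmxK opprB. Qed.

Lemma wedge_so x y : so (wedge x y).
Proof. exact: tr_wedge. Qed.

Lemma wedgeZl a x y : wedge (a *: x) y = a *: wedge x y.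
Proof. by apply/matrixP => i j; rewrite !mxE !big_ord1 !mxE; ring. Qed.

Lemma wedgeZr a x y : wedge x (a *: y) = a *: wedge x y.
Proof. by apply/matrixP => i j; rewrite !mxE !big_ord1 !mxE; ring. Qed.

Lemma wedgeDl x y z : wedge (x + y) z = wedge x z + wedge y z.
Proof. by apply/matrixP => i j; rewrite !mxE !big_ord1 !mxE; ring. Qed.

Lemma wedgeBl x y z : wedge (x - y) z = wedge x z - wedge y z.
Proof. by apply/matrixP => i j; rewrite !mxE !big_ord1 !mxE; ring. Qed.

Lemma wedge_mul X x y : wedge (X *m x) (X *m y) = X *m wedge x y *m X^T.
Proof.
by rewrite /wedge !trmx_mul mulmxBr mulmxBl !mulmxA.
Qed.

Lemma soB X Y : so X -> so Y -> so (X - Y).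
Proof.
by rewrite /so /= => hX hY; rewrite linearB /= hX hY opprB opprK addrC.
Qed.

Lemma soZ a X : so X -> so (a *: X).
Proof. by rewrite /so /= => hX; rewrite linearZ /= hX scalerN. Qed.

Lemma so_conj g X : so X -> so (g *m X *m g^T).
Proof.
by rewrite /so /= => hX; rewrite !trmx_mul trmxK hX mulNmx mulmxN mulmxA.
Qed.

Lemma so_dotv X x : so X -> dotv x (X *m x) = 0.
Proof.
move=> hX; have : dotv x (X *m x) = - dotv x (X *m x).
  by rewrite -{1}[X]trmxK -dotv_mull hX mulNmx dotvNl dotvC.
lra.
Qed.

Lemma so_dotC X Y : so_dot X Y = so_dot Y X.
Proof. by rewrite /so_dot mxtrace_mulC. Qed.

Lemma so_dotBl X Y Z : so_dot (X - Y) Z = so_dot X Z - so_dot Y Z.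
Proof. by rewrite /so_dot mulmxBl linearB /=; ring. Qed.

(** For skew X the form is half the sum of the squared entries. *)
Lemma so_dot_eq0 X : so X -> so_dot X X = 0 -> X = 0.
Proof.
move=> hX; rewrite /so_dot -[X in _ *m X]opprK -hX mulmxN linearN /=.
rewrite mulrN opprK => /eqP; rewrite mulf_eq0 invr_eq0 pnatr_eq0 /=.
rewrite /mxtrace psumr_eq0 => [/allP X0|i _]; last first.
  by rewrite mxE sumr_ge0// => j _; rewrite mxE -expr2 sqr_ge0.
apply/matrixP => i j; rewrite mxE; move: (X0 i).
rewrite mem_index_enum mxE psumr_eq0 => [/(_ isT)/allP/(_ j)|k _]; last first.
  by rewrite mxE -expr2 sqr_ge0.
by rewrite mem_index_enum mxE -expr2 sqrf_eq0 => /(_ isT)/eqP.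
Qed.

(** Consequently a skew X that kills gamma is orthogonal to all of v_gamma, which is how membership
    in h_gamma is checked below. *)
Lemma so_dot_wedge X x y : so X -> so_dot X (wedge x y) = dotv x (X *m y).
Proof.
move=> hX; rewrite /so_dot mulmxBr linearB /=.
have E u v : \tr (X *m (u *m v^T)) = dotv v (X *m u).
  by rewrite mulmxA mxtrace_mulC mulmx_trcol mxtrace_scalar mulr1n.
rewrite !E.
have -> : dotv y (X *m x) = - dotv x (X *m y).
  by rewrite dotvC dotv_mull hX mulNmx dotvNr.
lra.
Qed.

(** The right-hand side is skew and kills [x], so it lies in h_x, and it differs from X by an
    element of v_x. Since [pr_h] is a [get], uniqueness is needed too: two candidates differ by an
    element of h_x orthogonal to itself. *)
Lemma pr_hE x X : dotv x x = 1 -> so X -> pr_h x X = X - wedge (X *m x) x.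
Proof.
move=> x1 hX; set Z := X - _.
have hZ : so Z by apply: soB => //; exact: wedge_so.
have Zx : Z *m x = 0.
  by rewrite mulmxBl wedge_mulmx x1 scale1r dotvC so_dotv// scale0r subr0 subrr.
have Zh : h_space x Z.
  by split=> // _ [y _ <-]; rewrite so_dot_wedge// Zx /dotv mulmx0 mxE.
have XZ Y : h_space x Y -> so_dot (X - Z) Y = 0.
  move=> [_ hY]; rewrite /Z opprB addrC subrK so_dotC.
  by apply: hY; exists (X *m x).
apply: get_unique => [//|Z' [[hZ' Z'v] XZ']].
have D : h_space x (Z - Z').
  by split; [exact: soB | move=> Y vY; rewrite so_dotBl Zh.2// Z'v// subr0].
apply/esym/eqP; rewrite -subr_eq0; apply/eqP/so_dot_eq0; first exact: D.1.
have E : Z - Z' = (X - Z') - (X - Z).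
  by rewrite opprB [RHS]addrC addrA subrK.
by rewrite {1}E so_dotBl XZ// XZ'// subr0.
Qed.

End EuclideanAlgebra.

Section SpecialOrthogonal.
Context {R : realType} {n : nat}.
Implicit Types g : 'M[R]_n.

Lemma SO_unitmx g : SO g -> g \in unitmx.
Proof. by move=> [_ dg]; rewrite unitmxE dg unitr1. Qed.

Lemma SO_mulmx_tr g : SO g -> g *m g^T = 1%:M.
Proof. by move=> [gg _]; exact: mulmx1C. Qed.

Lemma SO_invmx g : SO g -> invmx g = g^T.
Proof.
by move=> gSO; rewrite -[RHS](mulmxK (SO_unitmx gSO)) gSO.1 mul1mx.
Qed.

End SpecialOrthogonal.

(* The constant kappa of the introductory comment. *)
Definition rolling_coef (R : realType) (m : rolling) (sigma rho : R) : R :=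
  (rolling_sign m * rho * center_dist m sigma rho)^-1.

(** * Explicit forms of the constraint distribution and of the vertical space *)

Section RollingGeometry.
Context {R : realType} {n : nat} {m : rolling} {sigma rho : R}.
Hypotheses (sigma_gt0 : 0 < sigma) (rho_gt0 : 0 < rho).
Hypothesis radii : rolling_radii m sigma rho.
Implicit Types (p w : ambient R n) (xi : 'cV[R]_n).

Local Notation s := (rolling_sign m : R).
Local Notation c := (center_dist m sigma rho).
Local Notation kappa := (rolling_coef m sigma rho).

Lemma rolling_sign_sqr : s * s = 1.
Proof. by rewrite /rolling_sign; case: (m); rewrite ?mulrNN ?mulr1. Qed.

Lemma rolling_sign_neq0 : s != 0.
Proof. by apply/eqP => s0; have := rolling_sign_sqr; rewrite s0 mul0r; lra. Qed.

Lemma center_dist_neq0 : c != 0.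
Proof.
rewrite /center_dist /rolling_sign; move: radii.
case: (m) => /= h; rewrite ?mul1r ?mulN1r ?subr_eq0.
- by rewrite gt_eqF// addr_gt0.
- by rewrite gt_eqF.
- by rewrite lt_eqF.
Qed.

Lemma kappa_center : s * rho * kappa * c = 1.
Proof.
rewrite /rolling_coef; field.
by rewrite center_dist_neq0 (gt_eqF rho_gt0) rolling_sign_neq0.
Qed.

Lemma config_gamma p : config m sigma rho p ->
  bundle_proj m sigma rho p = c^-1 *: (p.1^T *m p.2).
Proof. by move=> [pSO _]; rewrite /bundle_proj SO_invmx. Qed.

(** No twisting says omega = (omega gamma) /\ gamma, and no slipping says dr = s rho g omega gamma,
    because r = c g gamma. Conjugating the first by g and inserting the second eliminates omega and
    gives dg = kappa (dr /\ r) g. *)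
Lemma horizontalP p w : config m sigma rho p ->
  horizontal m sigma rho p w <->
  dotv p.2 w.2 = 0 /\ w.1 = kappa *: (wedge w.2 p.2 *m p.1).
Proof.
move=> pQ; have [pSO pc] := pQ; have c0 := center_dist_neq0.
have gg := SO_mulmx_tr pSO; have gg' := pSO.1.
have inv := SO_invmx pSO; have cK := kappa_center.
have [gam gamE] : exists gam, gam = c^-1 *: (p.1^T *m p.2) by eexists.
have gamr : p.1 *m gam = c^-1 *: p.2.
  by rewrite gamE -scalemxAr mulmxA gg mul1mx.
have gam1 : dotv gam gam = 1.
  rewrite gamE dotvZl dotvZr dotv_mull trmxK mulmxA gg mul1mx pc.
  by field.
have [om omdef] : exists om, om = p.1^T *m w.1 by eexists.
rewrite /horizontal /config_tangent /omega /Ad /= (config_gamma pQ) inv.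
rewrite -gamE -omdef.
have omE : p.1 *m om = w.1 by rewrite omdef mulmxA gg mul1mx.
split.
- move=> [[omso r0] drE]; rewrite pr_hE// => /eqP; rewrite subr_eq0 => /eqP omw.
  split=> //.
  have dr2 : w.2 = (s * rho) *: (p.1 *m (om *m gam)).
    rewrite drE gamE -!scalemxAr scalerA -!mulmxA; congr (_ *: _).
    by field.
  have r2 : p.2 = c *: (p.1 *m gam) by rewrite gamr scalerA mulfV// scale1r.
  rewrite dr2 [X in wedge _ X]r2 wedgeZl wedgeZr wedge_mul -omw !scalerA.
  rewrite -!scalemxAl -mulmxA gg' mulmx1 omE scalerA.
  by rewrite -[LHS]scale1r -cK; congr (_ *: _); ring.
- move=> [r0 dgE].
  have omw : om = kappa *: wedge (p.1^T *m w.2) (p.1^T *m p.2).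
    by rewrite omdef dgE -scalemxAr wedge_mul trmxK mulmxA.
  have omso : so om by rewrite omw; apply/soZ/wedge_so.
  (* Conversely, omega gamma is recovered from dr; both constraints follow from this value. *)
  have ogam : om *m gam = (kappa * c) *: (p.1^T *m w.2).
    rewrite omw gamE -scalemxAl -scalemxAr wedge_mulmx.
    rewrite !dotv_mull !trmxK !mulmxA gg !mul1mx pc [dotv w.2 _]dotvC r0.
    rewrite scale0r subr0 !scalerA; congr (_ *: _).
    by field.
  split=> //.
    rewrite -!mulmxA.
    have -> : p.1^T *m p.2 = c *: gam by rewrite gamE scalerA mulfV// scale1r.
    rewrite -!scalemxAr ogam -scalemxAr mulmxA gg mul1mx !scalerA.
    rewrite -[LHS]scale1r -cK; congr (_ *: _).
    by field.
  rewrite pr_hE// ogam gamE wedgeZl wedgeZr scalerA omw.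
  by rewrite -mulrA mulfV// mulr1 subrr.
Qed.

Lemma is_diff_bundle_proj p : config m sigma rho p ->
  is_diff p (bundle_proj m sigma rho)
    (fun w => c^-1 *: (p.1^T *m w.2 - p.1^T *m w.1 *m p.1^T *m p.2)).
Proof.
move=> [pSO pc].
have D1 := is_diff_comp (is_diff_lin p (@fst_continuous _ 'M[R]_n 'cV[R]_n))
  (is_diff_invmx (SO_unitmx pSO)).
have D2 := is_diff_bilinear (mulmx_bounded_bilinear R n n 1) D1
  (is_diff_lin p (@snd_continuous _ 'M[R]_n 'cV[R]_n)).
have D3 := is_diffZ c^-1 D2.
apply: is_diff_eq; apply/funext => v /=.
rewrite -[LHS]/(c^-1 *: (invmx p.1 *m v.2
  + - (invmx p.1 *m v.1 *m invmx p.1) *m p.2)).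
by rewrite mulNmx (SO_invmx pSO).
Qed.

(** Vanishing of the differential reads g^T dr = g^T dg g^T r, that is dr = eta r with eta = dg g^T.
    This eta is skew, being the conjugate of omega by g. *)
Lemma verticalP p w : config m sigma rho p ->
  vertical m sigma rho p w <->
  exists2 eta, so eta & w = (eta *m p.1, eta *m p.2).
Proof.
move=> pQ; have [pSO pc] := pQ; have c0 := center_dist_neq0.
have gg := SO_mulmx_tr pSO; have gg' := pSO.1.
rewrite /vertical /config_tangent /omega /= (SO_invmx pSO).
rewrite (@diff_val _ _ _ _ _ _ _ (is_diff_bundle_proj pQ)).
split=> [[[omso r0] /eqP]|[eta etaso ->]].
  rewrite scaler_eq0 invr_eq0 (negPf c0) /= subr_eq0 => /eqP dE.
  exists (w.1 *m p.1^T).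
    have -> : w.1 *m p.1^T = p.1 *m (p.1^T *m w.1) *m p.1^T.
      by rewrite mulmxA gg mul1mx.
    exact: so_conj.
  rewrite -!mulmxA gg' mulmx1 [LHS]surjective_pairing; congr (_, _).
  by rewrite -[w.2]mul1mx -gg -mulmxA dE !mulmxA gg mul1mx.
split; first split.
- by have := so_conj (p.1^T) etaso; rewrite trmxK mulmxA.
- exact: so_dotv.
- by rewrite /= -!mulmxA (mulmxA p.1 _ p.2) gg mul1mx subrr scaler0.
Qed.

End RollingGeometry.

(** * Reflections and stereographic parametrization of the unit sphere *)

Section Reflections.
Context {R : realType} {n : nat}.
Implicit Types (u x y v : 'cV[R]_n) (g : 'M[R]_n).

Lemma det_1_outer x y : \det (1%:M + x *m y^T) = 1 + dotv y x.
Proof.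
(* Sylvester's identity, by elementary block operations *)
pose L := block_mx (1%:M : 'M[R]_n) 0 y^T (1%:M : 'M[R]_1).
pose L' := block_mx (1%:M : 'M[R]_n) 0 (- y^T) (1%:M : 'M[R]_1).
pose M := block_mx (1%:M + x *m y^T) x 0 (1%:M : 'M[R]_1).
pose N := block_mx (1%:M : 'M[R]_n) x 0 (1%:M + y^T *m x).
have E : L *m M *m L' = N.
  rewrite /L /M /L' /N !mulmx_block !mul1mx !mul0mx !mulmx0 !mulmx1 !addr0.
  rewrite mulmxN addrK ?add0r mulmxDr mulmx1 mulmxDl mulmxN mul1mx.
  congr block_mx; last by rewrite addrC.
  by apply/eqP; rewrite mulmxA -opprD subr_eq0 addrC.
have : \det (L *m M *m L') = \det N by rewrite E.
rewrite !det_mulmx !det_ublock !det_lblock !det1 !(mul1r, mulr1) => ->.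
by rewrite mulmx_trcol det_mx11 !mxE eqxx.
Qed.

Definition householder u : 'M[R]_n := 1%:M - 2 *: (u *m u^T).

Lemma householder_tr u : (householder u)^T = householder u.
Proof. by rewrite /householder linearB linearZ /= trmx1 trmx_mul trmxK. Qed.

Lemma householder_mulmx u x : householder u *m x = x - (2 * dotv u x) *: u.
Proof. by rewrite mulmxBl mul1mx -scalemxAl outer_mulmx scalerA. Qed.

Lemma householderK u : dotv u u = 1 -> householder u *m householder u = 1%:M.
Proof.
move=> u1; rewrite {2}/householder mulmxBr mulmx1 -scalemxAr mulmxA.
rewrite householder_mulmx u1 mulr1 mulmxBl -scalemxAl /householder.
by apply/matrixP => i j; rewrite !mxE; ring.
Qed.

Lemma det_householder u : dotv u u = 1 -> \det (householder u) = -1.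
Proof.
move=> u1; have -> : householder u = 1%:M + (- 2 *: u) *m u^T.
  by rewrite -scalemxAl scaleNr.
by rewrite det_1_outer dotvZr u1; ring.
Qed.

Lemma householder2_SO u v g : dotv u u = 1 -> dotv v v = 1 -> SO g ->
  SO (householder u *m (householder v *m g)).
Proof.
move=> u1 v1 [gg dg]; split.
  rewrite !trmx_mul !householder_tr !mulmxA.
  rewrite -(mulmxA _ _ (householder u)) householderK// mulmx1.
  by rewrite -(mulmxA _ _ (householder v)) householderK// mulmx1.
by rewrite !det_mulmx !det_householder// dg; ring.
Qed.

(** The reflection in a moving unit vector u with velocity y has velocity - 2 (u y^T + y u^T). As
    the reflection is an involution, this equals - 2 (u /\ y) H_u, a skew matrix times a reflection,
    the shape occurring in [horizontalP]. *)
Lemma sym_outer_householder u y : dotv u u = 1 -> dotv u y = 0 ->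
  (u *m y^T + y *m u^T) *m householder u = wedge u y.
Proof.
move=> u1 uy; rewrite mulmxBr mulmx1 -scalemxAr mulmxDl !outerM.
rewrite [dotv y u]dotvC uy u1 scale0r add0r scale1r /wedge.
by apply/matrixP => i j; rewrite !mxE; ring.
Qed.

(* For y orthogonal to the unit vector u, this is the inverse of the
   stereographic projection from - u, normalized so that 0 is sent to u. *)
Definition stereo u y : 'cV[R]_n := (2 / (1 + dotv y y)) *: (u + y) - u.

Definition dstereo u y (dy : 'cV[R]_n) : 'cV[R]_n :=
  let a := (1 + dotv y y)^-1 in
  (2 * a) *: dy - (4 * a ^+ 2 * dotv y dy) *: (u + y).

Lemma stereo_den_gt0 y : 0 < 1 + dotv y y.
Proof. by rewrite ltr_pwDl ?dotv_ge0. Qed.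

Lemma stereo_den_neq0 y : 1 + dotv y y != 0.
Proof. by rewrite gt_eqF// stereo_den_gt0. Qed.

Lemma stereo0 u : stereo u 0 = u.
Proof.
rewrite /stereo [dotv _ _]/dotv mulmx0 mxE !addr0 divr1 scaler_nat mulr2n.
by rewrite addrK.
Qed.

Lemma stereo_unit u y : dotv u u = 1 -> dotv u y = 0 ->
  dotv (stereo u y) (stereo u y) = 1.
Proof.
move=> u1 uy; rewrite /stereo !(dotvBl, dotvBr, dotvZl, dotvZr, dotvDl, dotvDr).
rewrite [dotv y u]dotvC u1 uy; move: (stereo_den_neq0 y) => d0.
by field.
Qed.

End Reflections.

(** * Differentials of reflections and of the stereographic parametrization *)

Section ReflectionCalculus.
Context {R : realType} {n : nat} {V : normedModType R}.
Implicit Types (u : 'cV[R]_n).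

Lemma dotv_bounded_bilinear : bounded_bilinear (@dotv R n).
Proof.
split=> [x a y z|x a y z|].
- by rewrite dotvDr dotvZr.
- by rewrite dotvDl dotvZl.
- exists n%:R; split=> // x y; apply: le_trans (le_mx_norm _ 0 0) _.
  by rewrite -(mx_norm_tr x) mx_normM.
Qed.

Lemma wedge_bounded_bilinear : bounded_bilinear (@wedge R n).
Proof.
split=> [x a y z|x a y z|].
- by rewrite wedgeC wedgeDl wedgeZl opprD -scalerN -!wedgeC.
- by rewrite wedgeDl wedgeZl.
- exists 2; split=> // x y; apply: le_trans (ler_normB _ _) _.
  have := mx_normM x y^T; have := mx_normM y x^T.
  rewrite !mx_norm_tr [_ * `|y| * _]mulrAC => h1 h2.
  by apply: le_trans (lerD h2 h1) _; rewrite -!mulrA -mulrDl.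
Qed.

Lemma is_diff_inv (f df : V -> R) x : is_diff x f df -> f x != 0 ->
  is_diff x (fun y => (f y)^-1) (fun v => - (f x)^- 2 * df v).
Proof.
move=> Df fx0; have fd : differentiable f x := @ex_diff _ _ _ _ _ _ _ Df.
apply: DiffDef; first exact: differentiableV.
by rewrite diffV// (@diff_val _ _ _ _ _ _ _ Df).
Qed.

Lemma is_diff_householder (f df : V -> 'cV[R]_n) x : is_diff x f df ->
  is_diff x (fun y => householder (f y))
    (fun v => - 2 *: (f x *m (df v)^T + df v *m (f x)^T)).
Proof.
move=> Df.
have D1 := is_diff_comp Df (is_diff_lin (f x) (@trmx_continuous R n 1)).
have D2 := is_diff_bilinear (mulmx_bounded_bilinear R n 1 n) Df D1.
have D3 := is_diffB (is_diff_cst (1%:M : 'M[R]_n) x) (is_diffZ 2 D2).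
apply: is_diff_eq; apply/funext => v /=.
by rewrite -[LHS]/(0 - 2 *: (_ + _)) sub0r scaleNr.
Qed.

Lemma is_diff_stereo u (f df : V -> 'cV[R]_n) x : is_diff x f df ->
  is_diff x (fun y => stereo u (f y)) (fun v => dstereo u (f x) (df v)).
Proof.
move=> Df.
have D1 := is_diff_bilinear dotv_bounded_bilinear Df Df.
have D2 := is_diffD (is_diff_cst (1 : R) x) D1.
have D3 := is_diff_inv D2 (stereo_den_neq0 (f x)).
have D4 := is_diffZ 2 D3.
have D5 := is_diffD (is_diff_cst u x) Df.
have D6 := is_diff_bilinear (scale_bounded_bilinear 'cV[R]_n) D4 D5.
have D7 := is_diffB D6 (is_diff_cst u x).
apply: is_diff_eq; apply/funext => v /=.
rewrite -[LHS]/((2 * (1 + dotv (f x) (f x))^-1) *: (0 + df v) +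
  (2 * (- (1 + dotv (f x) (f x)) ^- 2 *
    (0 + (dotv (f x) (df v) + dotv (df v) (f x))))) *: (u + f x) - 0).
rewrite subr0 !add0r /dstereo -scaleNr [dotv (df v) _]dotvC; congr (_ + _ *: _).
by rewrite -exprVn; ring.
Qed.

(** Serves to differentiate the constraint equations along a curve on which they hold identically
    near the base point. *)
Lemma is_diff_eq0 (W : normedModType R) (f df : V -> W) x : is_diff x f df ->
  (\forall y \near x, f y = 0) -> forall v, df v = 0.
Proof.
move=> Df f0 v; rewrite -(@diff_val _ _ _ _ _ _ _ Df).
pose z : {linear V -> W} := \0.
have D : is_diff x f z.
  apply: (@is_diff_quadratic _ _ _ _ _ _ 0); first exact: cst_continuous.
  have /nbhs0P : \forall y \near x, f y = 0 by [].
  apply: filterS => h fh; rewrite fh (nbhs_singleton f0) !subr0 normr0.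
  by rewrite mul0r.
by rewrite (@diff_val _ _ _ _ _ _ _ D).
Qed.

End ReflectionCalculus.

(** * The bracket of horizontal fields and its vertical component *)

Section Curvature.
Context {R : realType} {n : nat} {m : rolling} {sigma rho : R}.
Hypotheses (sigma_gt0 : 0 < sigma) (rho_gt0 : 0 < rho).
Hypothesis radii : rolling_radii m sigma rho.
Implicit Types (p z w : ambient R n) (X : ambient R n -> ambient R n).

Local Notation s := (rolling_sign m : R).
Local Notation c := (center_dist m sigma rho).
Local Notation kappa := (rolling_coef m sigma rho).
Local Notation Q := (config m sigma rho).

(** Velocities are doubled at the base point, which accounts for the constants in [y1] and [y2]
    below. *)
Lemma is_diff_stereo_line (u y : 'cV[R]_n) :
  is_diff (0 : R) (fun t : R => stereo u (t *: y)) (fun t => (2 * t) *: y).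
Proof.
have D := is_diff_stereo u (is_diff_scalel (0 : R) y).
apply: is_diff_eq; apply/funext => t.
rewrite /dstereo !dotvZl !mul0r addr0 invr1 mulr0 scale0r subr0 mulr1.
by rewrite scalerA.
Qed.

Lemma contact_unit p : Q p -> dotv (c^-1 *: p.2) (c^-1 *: p.2) = 1.
Proof.
move=> [_ pc]; rewrite dotvZl dotvZr pc.
have c0 := center_dist_neq0 sigma_gt0 rho_gt0 radii.
by field.
Qed.

(** Horizontal extensions satisfy the constraints only on the configuration space, so these can be
    differentiated only along curves inside it. Only the velocity at 0 matters: the curve need not
    stay horizontal. *)
Lemma horizontal_curve p w : Q p -> horizontal m sigma rho p w ->
  exists zeta : R -> ambient R n,
    [/\ zeta 0 = p, forall t, Q (zeta t) &
        is_diff (0 : R) zeta (fun t => t *: w)].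
Proof.
move=> pQ wH; have [pSO pc] := pQ.
have c0 := center_dist_neq0 sigma_gt0 rho_gt0 radii.
have [r0 dgE] := (horizontalP sigma_gt0 rho_gt0 radii w pQ).1 wH.
have [u uE] : exists u, u = c^-1 *: p.2 by eexists.
have u1 : dotv u u = 1 by rewrite uE contact_unit.
have uw : dotv u w.2 = 0 by rewrite uE dotvZl r0 mulr0.
have ru : p.2 = c *: u by rewrite uE scalerA mulfV// scale1r.
pose y1 := (kappa * c / 4) *: w.2; pose y2 := (2 * c)^-1 *: w.2.
have uy1 : dotv u y1 = 0 by rewrite dotvZr uw mulr0.
have uy2 : dotv u y2 = 0 by rewrite dotvZr uw mulr0.
(* Reflecting in moving u(t) has twice the speed of u(t), whence the different
   speeds y1, y2 of the two components. *)
exists (fun t => (householder (stereo u (t *: y1)) *m (householder u *m p.1),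
                  c *: stereo u (t *: y2))).
split.
- rewrite !scale0r !stereo0 mulmxA householderK// mul1mx -ru.
  by rewrite -surjective_pairing.
- move=> t; split=> /=.
    by apply: householder2_SO => //; apply: stereo_unit => //;
      rewrite dotvZr uy1 mulr0.
  by rewrite dotvZl dotvZr stereo_unit ?mulr1// dotvZr uy2 mulr0.
- have D1 := is_diff_householder (is_diff_stereo_line u y1).
  have D2 := is_diff_bilinear (mulmx_bounded_bilinear R n n n) D1
    (is_diff_cst (householder u *m p.1) (0 : R)).
  have D3 := is_diffZ c (is_diff_stereo_line u y2).
  have D4 := is_diff_pair D2 D3.
  apply: is_diff_eq; apply/funext => t.
  rewrite [RHS]surjective_pairing; congr (_, _); last first.
    rewrite -[LHS]/(c *: ((2 * t) *: ((2 * c)^-1 *: w.2))) !scalerA.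
    by congr (_ *: _); field.
  rewrite mulmx0 add0r scale0r stereo0.
  rewrite -[LHS]/(- 2 *: (u *m ((2 * t) *: y1)^T + (2 * t) *: y1 *m u^T)
    *m (householder u *m p.1)).
  rewrite mulmxA -scalemxAl sym_outer_householder//; last first.
    by rewrite dotvZr uy1 mulr0.
  rewrite -[RHS]/(t *: w.1) dgE ru !wedgeZr [wedge u _]wedgeC.
  rewrite -[- wedge _ _]scaleN1r -!scalemxAl !scalerA; congr (_ *: _).
  by field.
Qed.

(** The two equations of [horizontalP] for X hold along the curve for small t; the product rule at t
    = 0 gives the two identities. *)
Lemma extension_tangent p z X w : Q p -> horizontal m sigma rho p w ->
  horizontal_extension m sigma rho p z X ->
  dotv p.2 ('d X p w).2 + dotv w.2 z.2 = 0 /\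
  ('d X p w).1 = kappa *: (wedge z.2 p.2 *m w.1 +
    (wedge z.2 w.2 + wedge ('d X p w).2 p.2) *m p.1).
Proof.
move=> pQ wH [Xp [U [Uo Up XS XH]]].
have [zeta [z0 zQ zD]] := horizontal_curve pQ wH.
have [Xd _] := XS 1%N.
have zc : {for 0, continuous zeta}.
  exact: (differentiable_continuous (@ex_diff _ _ _ _ _ _ _ zD)).
have zU : \forall t \near (0 : R), U (zeta t).
  by apply: zc; rewrite z0; apply: open_nbhs_nbhs; split.
have DX : is_diff (zeta 0) X ('d X p).
  by rewrite z0; apply: differentiableP; exact: Xd.
have D := is_diff_comp zD DX.
have D1 := is_diff_comp D
  (is_diff_lin (X (zeta 0)) (@fst_continuous _ 'M[R]_n 'cV[R]_n)).
have D2 := is_diff_comp D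
  (is_diff_lin (X (zeta 0)) (@snd_continuous _ 'M[R]_n 'cV[R]_n)).
have E1 := is_diff_comp zD
  (is_diff_lin (zeta 0) (@fst_continuous _ 'M[R]_n 'cV[R]_n)).
have E2 := is_diff_comp zD
  (is_diff_lin (zeta 0) (@snd_continuous _ 'M[R]_n 'cV[R]_n)).
have F1 := is_diff_bilinear dotv_bounded_bilinear E2 D2.
have F2 := is_diff_bilinear wedge_bounded_bilinear D2 E2.
have F3 := is_diff_bilinear (mulmx_bounded_bilinear R n n n) F2 E1.
have F4 := is_diffB D1 (is_diffZ kappa F3).
split.
  have := is_diff_eq0 F1 _ 1; rewrite /= z0 Xp !scale1r; apply.
  near=> t; rewrite /=.
  have tU : U (zeta t) by near: t.
  by have [] := (horizontalP sigma_gt0 rho_gt0 radii _ (zQ t)).1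
    (XH _ tU (zQ t)).
apply/eqP; rewrite -subr_eq0; apply/eqP.
have H : ('d X p (1 *: w)).1 - kappa *: (wedge (X (zeta 0)).2 (zeta 0).2 *m
    (1 *: w).1 + (wedge (X (zeta 0)).2 (1 *: w).2 +
    wedge ('d X p (1 *: w)).2 (zeta 0).2) *m (zeta 0).1) = 0.
  apply: (is_diff_eq0 F4 _ 1).
  near=> t; have tU : U (zeta t) by near: t.
  have [_ h] := (horizontalP sigma_gt0 rho_gt0 radii _ (zQ t)).1
    (XH _ tU (zQ t)).
  rewrite -[LHS]/((X (zeta t)).1 -
    kappa *: (wedge (X (zeta t)).2 (zeta t).2 *m (zeta t).1)).
  by rewrite h subrr.
by move: H; rewrite z0 Xp !scale1r.
Unshelve. all: by end_near. Qed.

(** After expansion all pairings of r with x or y vanish and the multiples of r r^T cancel. This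
    produces the c^2 in the curvature constant. *)
Lemma wedge_commutator (x y r : 'cV[R]_n) : dotv r x = 0 -> dotv r y = 0 ->
  wedge x r *m wedge y r - wedge y r *m wedge x r = - dotv r r *: wedge x y.
Proof.
move=> rx ry; rewrite /wedge !(mulmxBl, mulmxBr) !outerM.
rewrite [dotv x r]dotvC [dotv y r]dotvC [dotv y x]dotvC rx ry !scale0r !sub0r.
rewrite !subr0 scaleNr scalerBr; move: (_ *: (r *m r^T)) => M.
by rewrite !opprD !opprK addrACA addNr addr0.
Qed.

(** Subtract the two differentiated constraints. The antisymmetric terms z1 /\ z2 and - z2 /\ z1 add
    up to the 2, and the commutator of z1 /\ r and z2 /\ r contributes - kappa c^2. *)
Lemma horizontal_defect p z1 z2 d1 d2 : Q p ->
  horizontal m sigma rho p z1 -> horizontal m sigma rho p z2 ->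
  dotv p.2 d1.2 + dotv z2.2 z1.2 = 0 ->
  dotv p.2 d2.2 + dotv z1.2 z2.2 = 0 ->
  d1.1 = kappa *: (wedge z1.2 p.2 *m z2.1 +
    (wedge z1.2 z2.2 + wedge d1.2 p.2) *m p.1) ->
  d2.1 = kappa *: (wedge z2.2 p.2 *m z1.1 +
    (wedge z2.2 z1.2 + wedge d2.2 p.2) *m p.1) ->
  dotv p.2 (d1 - d2).2 = 0 /\
  (d1 - d2).1 = kappa *: (wedge (d1 - d2).2 p.2 *m p.1) +
    (kappa * (2 - kappa * c ^+ 2)) *: (wedge z1.2 z2.2 *m p.1).
Proof.
move=> pQ z1H z2H a1 a2 A1 A2; have [_ pc] := pQ.
have [r1 E1] := (horizontalP sigma_gt0 rho_gt0 radii _ pQ).1 z1H.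
have [r2 E2] := (horizontalP sigma_gt0 rho_gt0 radii _ pQ).1 z2H.
split=> /=.
  apply/eqP; rewrite dotvBr subr_eq0 -(inj_eq (addIr (dotv z2.2 z1.2))) a1.
  by rewrite [dotv z2.2 _]dotvC a2.
rewrite A1 A2 -scalerBr E1 E2 wedgeBl.
have := wedge_commutator r1 r2; rewrite pc [wedge z2.2 z1.2]wedgeC.
move: (wedge z1.2 p.2) (wedge z2.2 p.2) (wedge z1.2 z2.2) => P1 P2 W.
move: (wedge d1.2 p.2) (wedge d2.2 p.2) => D1 D2 /eqP.
rewrite subr_eq => /eqP P12.
rewrite -!scalemxAr !mulmxA P12 !mulmxDl !mulNmx -scalemxAl.
move: (P2 *m P1 *m p.1) (W *m p.1) (D1 *m p.1) (D2 *m p.1) => M1 M2 M3 M4.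
by apply/matrixP => i j; rewrite !mxE; ring.
Qed.

Lemma bracket_horizontal_defect p z1 z2 X1 X2 : Q p ->
  horizontal m sigma rho p z1 -> horizontal m sigma rho p z2 ->
  horizontal_extension m sigma rho p z1 X1 ->
  horizontal_extension m sigma rho p z2 X2 ->
  dotv p.2 (lie_bracket X2 X1 p).2 = 0 /\
  (lie_bracket X2 X1 p).1 =
    kappa *: (wedge (lie_bracket X2 X1 p).2 p.2 *m p.1) +
    (kappa * (2 - kappa * c ^+ 2)) *: (wedge z1.2 z2.2 *m p.1).
Proof.
move=> pQ z1H z2H X1H X2H.
have [a1 A1] := extension_tangent pQ z2H X1H.
have [a2 A2] := extension_tangent pQ z1H X2H.
rewrite /lie_bracket X1H.1 X2H.1.
exact: (horizontal_defect pQ z1H z2H a1 a2 A1 A2).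
Qed.

(** This number controls the splitting: it is the factor in the differential of the bundle map on
    horizontal vectors, and its being nonzero makes the vertical component unique. *)
Lemma one_minus_kappa : 1 - kappa * c ^+ 2 = - (sigma / (s * rho)).
Proof.
have c0 := center_dist_neq0 sigma_gt0 rho_gt0 radii.
have r0 : rho != 0 by rewrite gt_eqF.
have s0 := rolling_sign_neq0 (R := R) (m := m).
have cE : c = sigma + s * rho by [].
rewrite /rolling_coef expr2 invfM -mulrA mulKf// cE; field.
by rewrite r0 s0.
Qed.

Lemma one_minus_kappa_neq0 : 1 - kappa * c ^+ 2 != 0.
Proof.
rewrite one_minus_kappa oppr_eq0 mulf_neq0 ?invr_neq0 ?mulf_neq0 //.
- by rewrite gt_eqF.
- exact: rolling_sign_neq0.
- by rewrite gt_eqF.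
Qed.

Lemma vertical_component_iff p b (lam : R) (x y : 'cV[R]_n) (eta : 'M[R]_n) :
  Q p -> dotv p.2 b.2 = 0 -> dotv p.2 x = 0 -> dotv p.2 y = 0 ->
  b.1 = kappa *: (wedge b.2 p.2 *m p.1) + lam *: (wedge x y *m p.1) ->
  so eta ->
  vertical_component m sigma rho p b (inf_action eta p) <->
  eta = lam *: wedge x y.
Proof.
move=> pQ rb rx ry bE etaso; have [pSO pc] := pQ.
have gg := SO_mulmx_tr pSO.
have gI (M N : 'M[R]_n) : M *m p.1 = N *m p.1 -> M = N.
  by move=> /(congr1 (fun A => A *m p.1^T)); rewrite -!mulmxA gg !mulmx1.
rewrite inf_actionE /vertical_component.
rewrite (horizontalP sigma_gt0 rho_gt0 radii _ pQ) /=.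
have vert : vertical m sigma rho p (eta *m p.1, eta *m p.2).
  by apply/(verticalP sigma_gt0 rho_gt0 radii _ pQ); exists eta.
split.
- move=> [_ [_ H]].
  have E : eta = lam *: wedge x y + kappa *: wedge (eta *m p.2) p.2.
    apply: gI; rewrite mulmxDl -!scalemxAl.
    move: H; rewrite bE wedgeBl.
    move: (wedge b.2 p.2) (wedge (eta *m p.2) p.2) (wedge x y) => B E W.
    rewrite mulmxBl => /eqP; rewrite subr_eq => /eqP H.
    apply: (addrI (kappa *: (B *m p.1))); rewrite addrA H.
    by rewrite scalerBr [RHS]addrAC subrK.
  (* Apply both sides of [E] to r: x /\ y kills r, and ((eta r) /\ r) r = c^2 eta r because eta r is
     orthogonal to r. Hence eta r = 0 and the second term of [E] disappears. *)
  have /eqP : (1 - kappa * c ^+ 2) *: (eta *m p.2) = 0.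
    rewrite scalerBl scale1r {1}E mulmxDl -!scalemxAl !wedge_mulmx.
    rewrite [dotv x _]dotvC [dotv y _]dotvC rx ry !scale0r subr0 scaler0 add0r.
    by rewrite pc dotvC so_dotv// scale0r subr0 scalerA subrr.
  rewrite scaler_eq0 (negPf one_minus_kappa_neq0) /= => /eqP etar.
  have w0 : wedge (0 : 'cV[R]_n) p.2 = 0.
    by rewrite /wedge mul0mx trmx0 mulmx0 subrr.
  by rewrite E etar w0 scaler0 addr0.
- move=> E; split=> //; split; first by rewrite dotvBr rb so_dotv// subr0.
  have -> : eta *m p.2 = 0.
    by rewrite E -scalemxAl wedge_mulmx ![dotv _ p.2]dotvC rx ry !scale0r
      subr0 scaler0.
  by rewrite subr0 bE E -scalemxAl addrK.
Qed.

End Curvature.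

(** * Horizontal lifts and the curvature formula *)

Section CurvatureFormula.
Context {R : realType} {n : nat} {m : rolling} {sigma rho : R}.
Hypotheses (sigma_gt0 : 0 < sigma) (rho_gt0 : 0 < rho).
Hypothesis radii : rolling_radii m sigma rho.
Implicit Types (p z w : ambient R n).

Local Notation s := (rolling_sign m : R).
Local Notation c := (center_dist m sigma rho).
Local Notation kappa := (rolling_coef m sigma rho).
Local Notation Q := (config m sigma rho).

Lemma horizontal_extension_exists p z : Q p -> horizontal m sigma rho p z ->
  exists X, horizontal_extension m sigma rho p z X.
Proof.
move=> pQ zH; have [r0 zE] := (horizontalP sigma_gt0 rho_gt0 radii _ pQ).1 zH.
have c0 := center_dist_neq0 sigma_gt0 rho_gt0 radii.
(* The constant vector [z.2] is projected onto the orthogonal complement of r, with c^2 in place of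
   (r, r). This makes the field polynomial on the whole ambient space, while on the configuration
   space the two agree. *)
pose beta (q : ambient R n) := z.2 + (- c ^- 2 *: dotv z.2 q.2) *: q.2.
exists (fun q => (kappa *: (wedge (beta q) q.2 *m q.1), beta q)); split.
  rewrite /beta dotvC r0 scaler0 scale0r addr0 -zE.
  by rewrite -surjective_pairing.
exists setT; split=> //; first exact: openT.
- have S1 : smooth_on setT (fst : ambient R n -> _).
    exact: smooth_linear (@fst_continuous _ 'M[R]_n 'cV[R]_n).
  have S2 : smooth_on setT (snd : ambient R n -> _).
    exact: smooth_linear (@snd_continuous _ 'M[R]_n 'cV[R]_n).
  have Sd : smooth_on setT (fun q : ambient R n => - c ^- 2 *: dotv z.2 q.2).
    apply: (smooth_bilinear (scale_bounded_bilinear R)).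
      exact: smooth_cst.
    by apply: (smooth_bilinear dotv_bounded_bilinear) => //; exact: smooth_cst.
  have Sb : smooth_on setT beta.
    apply: smoothD; first exact: smooth_cst.
    exact: (smooth_bilinear (scale_bounded_bilinear 'cV[R]_n)).
  apply: smooth_pair => //.
  apply: (smooth_bilinear (scale_bounded_bilinear 'M[R]_n)).
    exact: smooth_cst.
  apply: (smooth_bilinear (mulmx_bounded_bilinear R n n n)) => //.
  exact: (smooth_bilinear wedge_bounded_bilinear).
- move=> q _ qQ; apply/(horizontalP sigma_gt0 rho_gt0 radii _ qQ); split=> //=.
  rewrite /beta dotvDr dotvZr qQ.2 [dotv z.2 _]dotvC.
  by rewrite -[_ *: dotv _ _]/(_ * _); field.
Qed.

(** The vertical component is the same for all extensions, and extensions exist, so the [get] has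
    exactly one candidate. *)
Lemma curvatureE p z1 z2 : Q p ->
  horizontal m sigma rho p z1 -> horizontal m sigma rho p z2 ->
  curvature m sigma rho p z1 z2 =
    (kappa * (2 - kappa * c ^+ 2)) *: wedge z1.2 z2.2.
Proof.
move=> pQ z1H z2H.
have [r1 _] := (horizontalP sigma_gt0 rho_gt0 radii _ pQ).1 z1H.
have [r2 _] := (horizontalP sigma_gt0 rho_gt0 radii _ pQ).1 z2H.
have vert X1 X2 eta : horizontal_extension m sigma rho p z1 X1 ->
    horizontal_extension m sigma rho p z2 X2 -> so eta ->
    vertical_component m sigma rho p (lie_bracket X2 X1 p) (inf_action eta p)
    <-> eta = (kappa * (2 - kappa * c ^+ 2)) *: wedge z1.2 z2.2.
  move=> X1H X2H etaso.
  have [rb bE] :=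
    bracket_horizontal_defect sigma_gt0 rho_gt0 radii pQ z1H z2H X1H X2H.
  exact: (vertical_component_iff sigma_gt0 rho_gt0 radii pQ rb r1 r2 bE).
apply: get_unique => /= [|eta [etaso [X1 [X2 [X1H X2H V]]]]]; last first.
  exact/(vert X1 X2).
have [X1 X1H] := horizontal_extension_exists pQ z1H.
have [X2 X2H] := horizontal_extension_exists pQ z2H.
have etaso := soZ (kappa * (2 - kappa * c ^+ 2)) (wedge_so z1.2 z2.2).
by split=> //; exists X1, X2; split=> //; apply/(vert X1 X2).
Qed.

Lemma diff_bundle_proj_horizontal p w : Q p -> horizontal m sigma rho p w ->
  'd (bundle_proj m sigma rho) p w =
  - (sigma / (s * rho * c)) *: (p.1^T *m w.2).
Proof.
move=> pQ wH; have [r0 wE] := (horizontalP sigma_gt0 rho_gt0 radii _ pQ).1 wH.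
rewrite (@diff_val _ _ _ _ _ _ _ (is_diff_bundle_proj pQ)) wE.
have [pSO pc] := pQ.
rewrite -scalemxAr -!scalemxAl -!mulmxA (mulmxA p.1 p.1^T) SO_mulmx_tr//.
rewrite mul1mx wedge_mulmx pc [dotv w.2 _]dotvC r0 scale0r subr0.
rewrite -scalemxAr scalerA -{1}[_ *m w.2]scale1r -scalerBl.
rewrite (one_minus_kappa sigma_gt0 rho_gt0 radii) scalerA.
by congr (_ *: _); rewrite !invfM; ring.
Qed.

(** On horizontal vectors the differential of the bundle map is a nonzero multiple of g^T dr.
    Inverting it gives dr, and the constraint then supplies dg; tangency of xi makes dr orthogonal
    to r. *)
Lemma horizontal_liftP p (xi : 'cV[R]_n) : Q p ->
  dotv (bundle_proj m sigma rho p) xi = 0 ->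
  horizontal m sigma rho p (horizontal_lift m sigma rho p xi) /\
  (horizontal_lift m sigma rho p xi).2 =
    - (s * rho * c / sigma) *: (p.1 *m xi).
Proof.
move=> pQ gx; have [pSO pc] := pQ.
have gg := SO_mulmx_tr pSO; have gg' := pSO.1.
have c0 := center_dist_neq0 sigma_gt0 rho_gt0 radii.
have r0 : rho != 0 by rewrite gt_eqF.
have sg0 : sigma != 0 by rewrite gt_eqF.
have s0 := rolling_sign_neq0 (R := R) (m := m).
pose b := - (s * rho * c / sigma) *: (p.1 *m xi).
have bH : horizontal m sigma rho p (kappa *: (wedge b p.2 *m p.1), b).
  apply/(horizontalP sigma_gt0 rho_gt0 radii _ pQ); split=> //=.
  move: gx; rewrite (config_gamma pQ) dotvZl => /eqP.
  rewrite mulf_eq0 invr_eq0 (negPf c0) /= dotv_mull trmxK => /eqP gx.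
  by rewrite dotvZr gx mulr0.
have [wH wE] : horizontal m sigma rho p (horizontal_lift m sigma rho p xi) /\
    'd (bundle_proj m sigma rho) p (horizontal_lift m sigma rho p xi) = xi.
  apply: (getPex (P := [set w | horizontal m sigma rho p w /\
    'd (bundle_proj m sigma rho) p w = xi])).
  exists (kappa *: (wedge b p.2 *m p.1), b); split=> //.
  rewrite diff_bundle_proj_horizontal//= /b -scalemxAr mulmxA gg' mul1mx.
  rewrite scalerA -[RHS]scale1r; congr (_ *: _); field.
  by rewrite c0 r0 s0 sg0.
split=> //; rewrite -{2}wE diff_bundle_proj_horizontal//.
rewrite -scalemxAr mulmxA gg mul1mx scalerA -[LHS]scale1r.
congr (_ *: _); field.
by rewrite c0 r0 s0 sg0.
Qed.

Lemma curvature_horizontal_lift p (xi1 xi2 : 'cV[R]_n) : Q p ->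
  dotv (bundle_proj m sigma rho p) xi1 = 0 ->
  dotv (bundle_proj m sigma rho p) xi2 = 0 ->
  curvature m sigma rho p (horizontal_lift m sigma rho p xi1)
    (horizontal_lift m sigma rho p xi2) =
  (1 - rho ^+ 2 / sigma ^+ 2) *: Ad p.1 (wedge xi2 xi1).
Proof.
move=> pQ g1 g2; have [h1 e1] := horizontal_liftP pQ g1.
have [h2 e2] := horizontal_liftP pQ g2.
rewrite curvatureE// e1 e2 wedgeZl wedgeZr wedge_mul !scalerA.
rewrite wedgeC mulmxN mulNmx scalerN -scaleNr /Ad (SO_invmx pQ.1).
have c0 := center_dist_neq0 sigma_gt0 rho_gt0 radii.
have r0 : rho != 0 by rewrite gt_eqF.
have sg0 : sigma != 0 by rewrite gt_eqF.
congr (_ *: _).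
have s0 := rolling_sign_neq0 (R := R) (m := m).
(* With s^2 kept in place of 1 the identity is rational in an arbitrary nonzero s, and [field]
   applies. *)
transitivity (1 - s * s * rho ^+ 2 / sigma ^+ 2); last first.
  by rewrite rolling_sign_sqr mul1r.
have cE : c = sigma + s * rho by [].
rewrite /rolling_coef cE in c0 *; field.
by rewrite c0 r0 s0 sg0.
Qed.

End CurvatureFormula.

(** * Tangent spaces of the stereographic parametrization, and the leaves *)

Section Leaf.
Context {R : realType} {n : nat}.
Implicit Types (u y dy w : 'cV[R]_n).

Lemma dstereo_tangent u y dy : dotv u u = 1 -> dotv u y = 0 ->
  dotv u dy = 0 -> dotv (stereo u y) (dstereo u y dy) = 0.
Proof.
move=> u1 uy udy; rewrite /stereo /dstereo.
rewrite !(dotvBl, dotvBr, dotvZl, dotvZr, dotvDl, dotvDr).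
rewrite [dotv y u]dotvC u1 uy udy; move: (stereo_den_neq0 y) => d0.
by field.
Qed.

(** Pairing with u isolates (y, dy); once these agree, the remaining term determines dy. *)
Lemma dstereo_inj u y dy1 dy2 : dotv u u = 1 -> dotv u y = 0 ->
  dotv u dy1 = 0 -> dotv u dy2 = 0 ->
  dstereo u y dy1 = dstereo u y dy2 -> dy1 = dy2.
Proof.
move=> u1 uy u1d u2d; rewrite /dstereo => E.
have a0 : (1 + dotv y y)^-1 != 0 by rewrite invr_eq0 stereo_den_neq0.
have T dy : dotv u dy = 0 ->
    dotv u ((2 * (1 + dotv y y)^-1) *: dy -
      (4 * (1 + dotv y y)^-1 ^+ 2 * dotv y dy) *: (u + y)) =
    - (4 * (1 + dotv y y)^-1 ^+ 2) * dotv y dy.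
  by move=> h; rewrite dotvBr !dotvZr dotvDr u1 uy h; ring.
have /mulfI t : - (4 * (1 + dotv y y)^-1 ^+ 2) != 0.
  by rewrite oppr_eq0 mulf_neq0 ?expf_neq0.
have {t} t : dotv y dy1 = dotv y dy2 by apply: t; rewrite -!T// E.
by move: E; rewrite t => /addIr /scalerI; apply; rewrite mulf_neq0.
Qed.

Lemma dstereo_surj u y w : dotv u u = 1 -> dotv u y = 0 ->
  dotv (stereo u y) w = 0 -> exists2 dy, dotv u dy = 0 & dstereo u y dy = w.
Proof.
move=> u1 uy; rewrite /stereo dotvBl dotvZl dotvDl => uw.
have d0 := stereo_den_neq0 y.
set q := dotv y y in uw d0 *.
have yw : dotv y w = dotv u w * (q - 1) / 2.
  have -> : dotv y w = (2 / (1 + q) * (dotv u w + dotv y w) - dotv u w)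
      * (1 + q) / 2 + dotv u w * (q - 1) / 2 by field.
  by rewrite uw !mul0r add0r.
(* Pairing [dstereo u y dy = w] with u shows that the coefficient of u + y must be (u, w); solving
   for dy gives this vector. *)
exists (((1 + q) / 2) *: (w - dotv u w *: (u + y))).
  by rewrite dotvZr dotvBr dotvZr dotvDr u1 uy; ring.
have t : dotv y (((1 + q) / 2) *: (w - dotv u w *: (u + y))) =
    - dotv u w * (1 + q) ^+ 2 / 4.
  rewrite dotvZr dotvBr dotvZr dotvDr [dotv y u]dotvC uy yw -/q.
  by field.
rewrite /dstereo t -/q scalerA.
have -> : 2 * (1 + q)^-1 * ((1 + q) / 2) = 1 by field.
have -> : 4 * (1 + q)^-1 ^+ 2 * (- dotv u w * (1 + q) ^+ 2 / 4) = - dotv u w.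
  by field.
by rewrite scale1r scaleNr opprK subrK.
Qed.

(** Integral manifolds are parametrized by column vectors, so the hyperplane orthogonal to u needs
    linear coordinates: the columns of N form a basis of it. *)
Lemma orthogonal_parametrization u : exists k (N : 'M[R]_(n, k)),
  [/\ forall x, dotv u (N *m x) = 0, injective (mulmx N : 'cV_k -> _) &
      forall dy, dotv u dy = 0 -> exists v, dy = N *m v].
Proof.
have [B [Bfree BE]] : exists B : 'M[R]_(\rank (kermx u), n),
    row_free B /\ (B :=: kermx u)%MS.
  by exists (row_base (kermx u)); split;
    [exact: row_base_free | exact: eq_row_base].
have Bu : B *m u = 0 by apply/sub_kermxP; rewrite BE.
exists (\rank (kermx u)), B^T; split=> [x|x1 x2 E|dy udy].
- by rewrite dotvC dotv_mull trmxK Bu /dotv mulmx0 mxE.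
- apply: trmx_inj; apply: (row_free_inj Bfree).
  by apply: trmx_inj; rewrite !trmx_mul !trmxK.
- have : (dy^T <= B)%MS.
    rewrite BE; apply/sub_kermxP.
    by rewrite mulmx_trcol dotvC udy raddf0.
  by case/submxP => D E; exists D^T; rewrite -trmx_mul -E trmxK.
Qed.

End Leaf.

Section SmoothReflections.
Context {R : realType} {n : nat} {V : normedModType R}.

Lemma smooth_householder (f : V -> 'cV[R]_n) : smooth_on setT f ->
  smooth_on setT (fun x => householder (f x)).
Proof.
move=> fS; apply: smoothD; first exact: smooth_cst.
apply: smoothN; apply: (smooth_bilinear (scale_bounded_bilinear 'M[R]_n)).
  exact: smooth_cst.
apply: (smooth_bilinear (mulmx_bounded_bilinear R n 1 n)) => //.
exact: (smooth_linear_comp (@trmx_continuous R n 1) fS).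
Qed.

Lemma smooth_stereo u (f : V -> 'cV[R]_n) : smooth_on setT f ->
  smooth_on setT (fun x => stereo u (f x)).
Proof.
move=> fS; apply: smoothD; last exact: smooth_cst.
apply: (smooth_bilinear (scale_bounded_bilinear 'cV[R]_n)); last first.
  by apply: smoothD => //; exact: smooth_cst.
apply: (smooth_bilinear (scale_bounded_bilinear R)); first exact: smooth_cst.
apply: smoothV => [x|]; first exact: stereo_den_neq0.
apply: smoothD; first exact: smooth_cst.
exact: (smooth_bilinear dotv_bounded_bilinear fS fS).
Qed.

End SmoothReflections.

Section IntegrableCase.
Context {R : realType} {n : nat} {m : rolling} {sigma rho : R}.
Hypotheses (sigma_gt0 : 0 < sigma) (rho_gt0 : 0 < rho).
Hypothesis radii : rolling_radii m sigma rho.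

Local Notation s := (rolling_sign m : R).
Local Notation c := (center_dist m sigma rho).
Local Notation kappa := (rolling_coef m sigma rho).
Local Notation Q := (config m sigma rho).

Lemma horizontal_integrable : kappa * c ^+ 2 = 2 ->
  integrable_distribution Q (horizontal m sigma rho : ambient R n -> set _).
Proof.
move=> kc p pQ; have [pSO pc] := pQ.
have c0 := center_dist_neq0 sigma_gt0 rho_gt0 radii.
have [u uE] : exists u, u = c^-1 *: p.2 by eexists.
have u1 : dotv u u = 1 by rewrite uE (contact_unit sigma_gt0 rho_gt0 radii).
have ru : p.2 = c *: u by rewrite uE scalerA mulfV// scale1r.
have [k [N [Nu Ninj Nsurj]]] := orthogonal_parametrization u.
pose v (x : 'cV[R]_k) := stereo u (N *m x).
pose phi (x : 'cV[R]_k) : ambient R n :=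
  (householder (v x) *m (householder u *m p.1), c *: v x).
have v1 x : dotv (v x) (v x) = 1 by exact: stereo_unit.
have phiQ x : Q (phi x).
  split; first exact: householder2_SO.
  by rewrite /= dotvZl dotvZr v1 mulr1.
have vd x dx : dotv (v x) (dstereo u (N *m x) (N *m dx)) = 0.
  exact: dstereo_tangent.
have phiD x : is_diff x phi (fun dx =>
    (- 2 *: (v x *m (dstereo u (N *m x) (N *m dx))^T +
             dstereo u (N *m x) (N *m dx) *m (v x)^T)
       *m (householder u *m p.1), c *: dstereo u (N *m x) (N *m dx))).
  have D1 := is_diff_stereo u
    (is_diff_lin x (@mulmx_continuous R n k 1 N)).
  have D2 := is_diff_bilinear (mulmx_bounded_bilinear R n n n)
    (is_diff_householder D1) (is_diff_cst (householder u *m p.1) x).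
  have D3 := is_diff_pair D2 (is_diffZ c D1).
  apply: is_diff_eq; apply/funext => dx.
  by rewrite mulmx0 add0r.
(* This is where kappa c^2 = 2 enters: the reflection has velocity 2 (dv /\ v) times itself, whereas
   the constraint asks for kappa (c dv) /\ (c v). *)
have dphi x dx : 'd phi x dx =
    (kappa *: (wedge (c *: dstereo u (N *m x) (N *m dx)) (phi x).2
       *m (phi x).1), c *: dstereo u (N *m x) (N *m dx)).
  rewrite (@diff_val _ _ _ _ _ _ _ (phiD x)); congr (_, _).
  rewrite -[v x *m _ + _]mulmx1 -(householderK (v1 x)) (mulmxA (_ + _)).
  rewrite sym_outer_householder// wedgeZl wedgeZr [wedge (v x) _]wedgeC.
  rewrite -[- wedge _ _]scaleN1r -!scalemxAl !scalerA -mulrA -expr2 kc.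
  by rewrite !mulmxA; congr (_ *: _); ring.
exists k, setT, phi; split => //.
- exact: openT.
- rewrite /phi /v mulmx0 stereo0 mulmxA householderK// mul1mx -ru.
  by rewrite -surjective_pairing.
- have vS : smooth_on setT v.
    by apply: smooth_stereo; exact: smooth_linear (@mulmx_continuous R n k 1 N).
  apply: smooth_pair.
    apply: (smooth_bilinear (mulmx_bounded_bilinear R n n n)).
      exact: smooth_householder.
    exact: smooth_cst.
  apply: (smooth_bilinear (scale_bounded_bilinear 'cV[R]_n)) => //.
  exact: smooth_cst.
- move=> x _; split=> //.
    move=> dx1 dx2; rewrite !dphi => -[_ E'].
    have E := scalerI c0 E'.
    by apply: Ninj; exact: (dstereo_inj u1 (Nu x) (Nu _) (Nu _) E).
  apply/seteqP; split=> [_ [dx _ <-]|w wH].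
    rewrite dphi; apply/(horizontalP sigma_gt0 rho_gt0 radii _ (phiQ x)).
    by split=> //=; rewrite dotvZl dotvZr vd !mulr0.
  have [r0 wE] := (horizontalP sigma_gt0 rho_gt0 radii _ (phiQ x)).1 wH.
  (* A horizontal vector is determined by its dr-component, so it suffices to reach dr / c, a
     tangent vector of the unit sphere at [v x], by the stereographic differential. *)
  have : dotv (v x) (c^-1 *: w.2) = 0.
    move: r0; rewrite /= dotvZl dotvZr => /eqP.
    by rewrite mulf_eq0 (negPf c0) /= => /eqP ->; rewrite mulr0.
  case/(dstereo_surj u1 (Nu x)) => dy udy dyE.
  have [dx dxE] := Nsurj _ udy; exists dx => //.
  rewrite dphi -dxE dyE scalerA mulfV// scale1r -wE.
  by rewrite -surjective_pairing.
Qed.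

End IntegrableCase.

(** * The case epsilon = 1/2, and the final result *)

Lemma epsilon_half (R : realType) (m : rolling) (sigma rho : R) :
  0 < sigma -> 0 < rho -> rolling_radii m sigma rho ->
  epsilon m sigma rho = 2^-1 <-> rolling_sign m * rho = sigma.
Proof.
move=> sigma_gt0 rho_gt0 radii.
have c0 := center_dist_neq0 sigma_gt0 rho_gt0 radii.
have cE : center_dist m sigma rho = sigma + rolling_sign m * rho by [].
rewrite /epsilon; split=> E.
- have c2 : center_dist m sigma rho = 2 * sigma.
    by rewrite -[LHS]mulr1 -[X in _ * X](@mulfV _ 2)// -E; field.
  by apply: (addrI sigma); rewrite -cE c2; ring.
- have s0 : sigma != 0 by rewrite gt_eqF.
  by rewrite cE E -mulr2n -[X in _ / X]mulr_natr invfM mulrA mulfV ?mul1r.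
Qed.

(** For sign - both sides are false: - rho = sigma contradicts positivity, and rho = sigma
    contradicts the strict inequality between the radii. *)
Lemma rolling_sign_mul_eq (R : realType) (m : rolling) (sigma rho : R) :
  0 < sigma -> 0 < rho -> rolling_radii m sigma rho ->
  rolling_sign m * rho = sigma <-> rho = sigma.
Proof.
rewrite /rolling_sign; case: m => /= s0 r0 h; first by rewrite mul1r.
  by split=> E; exfalso; move: s0 r0 h E; rewrite ?mulN1r; lra.
by split=> E; exfalso; move: s0 r0 h E; rewrite ?mulN1r; lra.
Qed.

Theorem lemma7 (R : realType) (n : nat) (m : rolling) (sigma rho : R)
    (sigma_gt0 : 0 < sigma) (rho_gt0 : 0 < rho)
    (radii : rolling_radii m sigma rho) :
  let eps := epsilon m sigma rho in
  let Q : set (ambient R n) := config m sigma rho in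
  let F : ambient R n -> set (ambient R n) := horizontal m sigma rho in
  let K := @curvature R n m sigma rho in
  let hlift := @horizontal_lift R n m sigma rho in
  [/\ forall (gamma xi1 xi2 : 'cV[R]_n) (g : 'M[R]_n) (r : 'cV[R]_n),
        unit_sphere gamma ->
        sphere_tangent gamma xi1 -> sphere_tangent gamma xi2 ->
        Q (g, r) -> bundle_proj m sigma rho (g, r) = gamma ->
        K (g, r) (hlift (g, r) xi1) (hlift (g, r) xi2)
          = (1 - rho ^+ 2 / sigma ^+ 2) *: Ad g (wedge xi2 xi1) /\
        K (g, r) (hlift (g, r) xi1) (hlift (g, r) xi2)
          = ((2 * eps - 1) / eps ^+ 2) *: Ad g (wedge xi2 xi1),
      eps = 2^-1 <-> rho = sigma &
      eps = 2^-1 ->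
        (forall p z1 z2, Q p -> F p z1 -> F p z2 -> K p z1 z2 = 0) /\
        integrable_distribution Q F].
Proof.
move=> eps Q F K hlift.
have c0 := center_dist_neq0 sigma_gt0 rho_gt0 radii.
have sg0 : sigma != 0 by rewrite gt_eqF.
have r0 : rho != 0 by rewrite gt_eqF.
have cE : center_dist m sigma rho = sigma + rolling_sign m * rho by [].
split.
- move=> gamma xi1 xi2 g r _ t1 t2 pQ pg.
  have E : K (g, r) (hlift (g, r) xi1) (hlift (g, r) xi2) =
      (1 - rho ^+ 2 / sigma ^+ 2) *: Ad g (wedge xi2 xi1).
    by apply: (curvature_horizontal_lift sigma_gt0 rho_gt0 radii pQ);
      rewrite pg.
  split=> //; rewrite E; congr (_ *: _); rewrite /eps /epsilon.
  transitivity (1 - rolling_sign m * rolling_sign m * rho ^+ 2 / sigma ^+ 2).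
    by rewrite rolling_sign_sqr mul1r.
  rewrite cE in c0 *; field.
  by rewrite c0 sg0.
- exact: iff_trans (epsilon_half sigma_gt0 rho_gt0 radii)
    (rolling_sign_mul_eq sigma_gt0 rho_gt0 radii).
- move=> /(epsilon_half sigma_gt0 rho_gt0 radii) sr.
  (* Here c = 2 sigma and kappa = 1 / (2 sigma^2). The same identity makes the curvature vanish and
     the reflected leaves horizontal. *)
  have kc : rolling_coef m sigma rho * center_dist m sigma rho ^+ 2 = 2.
    rewrite cE sr in c0; rewrite /rolling_coef cE sr; field.
    by rewrite c0 sg0.
  split; last exact: (horizontal_integrable sigma_gt0 rho_gt0 radii kc).
  move=> p z1 z2 pQ h1 h2.
  by rewrite /K (curvatureE sigma_gt0 rho_gt0 radii)// kc subrr mulr0 scale0r.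
Qed.
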